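(* Let $\mathcal Z$ be a finite dimensional inner product space, let $(f_1,f_2,h)$ and $(m_1,M_1,m_2,M_2)\in\mathbb R^4$ satisfy assumptions (A1)--(A4) listed in the context, let $\phi=f_1+f_2+h$, assume that $\operatorname{dom}h$ is closed and that $\Omega\supseteq\operatorname{dom}h$ is a bounded set for which a projection oracle exists. Let $\hat\rho>0$, $y_0\in\operatorname{dom}h$, and let $(\lambda,\theta)\in(0,\infty)\times(0,1)$ satisfy $\lambda M_1+\theta^2\le\frac12$. Set $L_i=\max\{|m_i|,|M_i|\}$, $m_1^+=\max\{m_1,0\}$, $M_2^+=\max\{M_2,0\}$, $\phi_*=\inf_{\mathcal Z}\phi$, and $$D_h:=\sup_{u,z\in\operatorname{dom}h}\|u-z\|,\quad D_\Omega:=\sup_{u,z\in\Omega}\|u-z\|,\quad \Delta_\phi^0:=\phi(y_0)-\phi_*,\quad d_0:=\inf_{u^*\in\mathcal Z}\{\|y_0-u^*\|:\phi(u^* )=\phi_*\},$$ $$\overline C_\lambda:=\frac{1+\lambda(M_2^++L_1+L_2)}{\sqrt{1+\lambda M_2^+}},\qquad E_{\lambda,\theta}:=\sqrt\lambda L_1+\frac{1+\theta\overline C_\lambda}{\sqrt\lambda}.$$ The following statements hold about the static DA-ICG method (defined in the context) run with these inputs: (a) it stops (with success or failure) in $$\mathcal O_1\left(\frac{E_{\lambda,\theta}^2[m_1^+D_h^2+\Delta_\phi^0]}{\hat\rho^2}+\frac{E_{\lambda,\theta}[m_1^++1/\lambda]^{1/2}D_\Omega}{\hat\rho}\right)$$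 outer iterations; (b) if it stops with success, then its output pair $(\hat y,\hat v)$ satisfies $\hat v\in\nabla f_1(\hat y)+\nabla f_2(\hat y)+\partial h(\hat y)$ and $\|\hat v\|\le\hat\rho$; (c) if $f_2$ is convex, then it always stops with success in $$\mathcal O_1\left(\frac{E_{\lambda,\theta}^2m_1^+D_h^2}{\hat\rho^2}+\frac{E_{\lambda,\theta}[m_1^+]^{1/2}D_\Omega}{\hat\rho}+\frac{E_{\lambda,\theta}^{2/3}d_0^{2/3}\lambda^{-1/3}}{\hat\rho^{2/3}}\right)$$ outer iterations.
   Context: Notation. $\overline{\mathrm{Conv}}\,\mathcal Z$ is the set of proper lower semicontinuous convex functions $\mathcal Z\to(-\infty,\infty]$; $\ell_g(u;y):=g(y)+\langle\nabla g(y),u-y\rangle$; $\partial h$ is the convex subdifferential. $\mathcal O_1(\cdot)$ means $\mathcal O(1+\cdot)$. Assumptions. (A1) $h\in\overline{\mathrm{Conv}}\,\mathcal Z$. (A2) $f_1,f_2$ are continuously differentiable and, for $i\in\{1,2\}$, $-\frac{m_i}2\|u-y\|^2\le f_i(u)-\ell_{f_i}(u;y)\le\frac{M_i}2\|u-y\|^2$ for all $u,y\in\operatorname{dom}h$. (A3) $\|\nabla f_i(u)-\nabla f_i(y)\|\le L_i\|u-y\|$ for all $u,y\in\operatorname{dom}h$, $i\in\{1,2\}$. (A4) $\phi_*>-\infty$. For $\psi=\psi_s+\psi_n$ and $\mu>0$, let $$\Delta_\mu(u;y,v):=\psi(y)-\psi(u)-\langle v,y-u\rangle+\tfrac\mu2\|u-y\|^2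 ,\quad u\in\operatorname{dom}\psi .$$ Refinement procedure $RP(y,v)$, for $(M,\psi_s,\psi_n)$: output $(y_r,v_r)$ with $y_r=\operatorname{argmin}_{u}\{\langle\nabla\psi_s(y)-v,u\rangle+\frac M2\|u-y\|^2+\psi_n(u)\}$ and $v_r=v+M(y-y_r)+\nabla\psi_s(y_r)-\nabla\psi_s(y)$. R-ACG algorithm. Input: $(\mu,M,\psi_s,\psi_n)$ with $\mu>0$, $M\ge0$, $\psi_n\in\overline{\mathrm{Conv}}\,\mathcal Z$, $\psi_s$ continuously differentiable on $\mathcal Z$ with $\psi_s(u)-\ell_{\psi_s}(u;y)\le\frac M2\|u-y\|^2$ for all $u,y\in\mathcal Z$; and $(\theta,z_0)\in(0,\infty)\times\mathcal Z$. Step 0: $\psi=\psi_s+\psi_n$, $z_0^c=z_0$, $B_0=0$, $\Gamma_0\equiv0$, $j=1$. Step 1: $\xi_{j-1}=\frac{1+\mu B_{j-1}}{M-\mu}$, $b_{j-1}=\frac{\xi_{j-1}+\sqrt{\xi_{j-1}^2+4\xi_{j-1}B_{j-1}}}2$, $B_j=B_{j-1}+b_{j-1}$, $\tilde z_{j-1}=\frac{B_{j-1}}{B_j}z_{j-1}+\frac{b_{j-1}}{B_j}z^c_{j-1}$, $z_j=\operatorname{argmin}_u\{\ell_{\psi_s}(u;\tilde z_{j-1})+\psi_n(u)+\frac M2\|u-\tilde z_{j-1}\|^2\}$, $z_j^c=\frac1{1+\mu B_j}[z^c_{j-1}-b_{j-1}(M-\mu)(\tilde z_{j-1}-z_j)+\mu(B_{j-1}z^c_{j-1}+b_{j-1}z_j)]$.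 Step 2: $\tilde\gamma_j=\ell_{\psi_s}(\cdot;\tilde z_{j-1})+\psi_n+\frac\mu2\|\cdot-\tilde z_{j-1}\|^2$, $\gamma_j=\tilde\gamma_j(z_j)+(M-\mu)\langle\tilde z_{j-1}-z_j,\cdot-z_j\rangle+\frac\mu2\|\cdot-z_j\|^2$, $\Gamma_j=\frac{B_{j-1}}{B_j}\Gamma_{j-1}+\frac{b_{j-1}}{B_j}\gamma_j$, $r_j=\frac{z_0^c-z_j^c}{B_j}+\mu(z_j-z_j^c)$, $\eta_j=\max\{0,\psi(z_j)-\Gamma_j(z_j^c)-\langle r_j,z_j-z_j^c\rangle+\frac\mu2\|z_j-z_j^c\|^2\}$. Step 3: if $\frac1{1+\mu B_j}\|B_jr_j+z_j-z_0\|^2+2B_j\eta_j\le\|z_j-z_0\|^2$ go to step 4; otherwise stop with failure. Step 4: if $\|r_j\|^2+2\eta_j\le\theta^2\|z_j-z_0\|^2$ go to step 5; otherwise set $j\leftarrow j+1$ and go to step 1. Step 5: set $(y,v,\varepsilon)=(z_j,r_j,\eta_j)$ and $(y_r,v_r)=RP(y,v)$; if $\Delta_\mu(y_r;y,v)\le\varepsilon$ stop with success and output $(y,v,\varepsilon)$; otherwise stop with failure. For a point $z_0$ write $$( * )\quad \mu=1,\ M=\lambda M_2^++1,\ \psi_s=\lambda[\ell_{f_1}(\cdot;z_0)+f_2]+\tfrac12\|\cdot-z_0\|^2,\ \psi_n=\lambda h .$$ Specialized refinement $SRP(y,v,z_0)$: compute $(\hat y,v_r)=RP(y,v)$ with $(M,\psi_s,\psi_n)$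 as in $( * )$, set $\hat v=\frac1\lambda(v_r+z_0-\hat y)+\nabla f_1(\hat y)-\nabla f_1(z_0)$, and output $(\hat y,\hat v)$. Static DA-ICG method. Step 0: $A_0=0$, $x_0=y_0$, $k=1$. Step 1: $a_{k-1}=\frac{1+\sqrt{1+4A_{k-1}}}2$, $A_k=A_{k-1}+a_{k-1}$, $\tilde x_{k-1}=\frac{A_{k-1}y_{k-1}+a_{k-1}x_{k-1}}{A_k}$. Step 2: call R-ACG with inputs $( * )$, $z_0=\tilde x_{k-1}$, and $\theta$; if it fails, stop with failure; otherwise let $(y_k^a,v_k,\varepsilon_k)$ be its output. Step 3: if $\Delta_1(y_{k-1};y_k^a,v_k)\le\varepsilon_k$ (with $\psi_s,\psi_n$ as in $( * )$, $z_0=\tilde x_{k-1}$) go to step 4; otherwise stop with failure. Step 4: set $(\hat y_k,\hat v_k)=SRP(y_k^a,v_k,\tilde x_{k-1})$; if $\|\hat v_k\|\le\hat\rho$ stop with success and output $(\hat y,\hat v)=(\hat y_k,\hat v_k)$; otherwise set $x_k=\operatorname{argmin}_{u\in\Omega}\frac12\|u-[x_{k-1}-a_{k-1}(v_k+\tilde x_{k-1}-y_k^a)]\|^2$, $y_k=\operatorname{argmin}_{u\in\{y_{k-1},y_k^a\}}\phi(u)$, $k\leftarrow k+1$, and go to step 1. The iterations indexed by $k$ are the outer iterations.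
   Formalization: The bounds of (A2) and (A3) for f_1 are also assumed for u in dom h and y in Ω, since (c) fails otherwise; M_2>0 is assumed, as R-ACG divides by M-μ; and the R-ACG input condition is assumed, i.e. the upper bound of (A2) for f_2 with M_2 on all of Z. *)

(* Defs.v *)
From HB Require Import structures.
From mathcomp Require Import all_boot all_order all_algebra.
From mathcomp Require Import all_classical all_reals all_analysis.

Set Implicit Arguments.
Unset Strict Implicit.
Unset Printing Implicit Defensive.

Import Order.TTheory GRing.Theory Num.Theory.
Import numFieldNormedType.Exports.

Local Open Scope classical_set_scope.
Local Open Scope ring_scope.

Definition is_argmin (T : Type) (d : Order.disp_t) (O : porderType d)
    (S : set T) (F : T -> O) (x : T) : Prop :=
  S x /\ forall u, S u -> (F x <= F u)%O.

Section Space.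
Context {R : realType} {Z : normedModType R}.

(* Together with the norm condition, finite dimensionality makes
   [Z], equipped with [ip], a finite dimensional inner product space whose
   topology is the one induced by [ip]. *)
Definition fin_dim_inner_product (ip : {dot Z for idfun}) : Prop :=
  (forall x, `|x| = Num.sqrt (ip x x)) /\
  exists (n : nat) (e : 'I_n -> Z),
    forall x, exists c : 'I_n -> R, x = \sum_(i < n) c i *: e i.

Definition dom (h : Z -> \bar R) : set Z := [set x | (h x < +oo)%E].

(* Proper, lower semicontinuous and convex; recall that 0 * +oo = 0. *)
Definition Conv (h : Z -> \bar R) : Prop :=
  [/\ forall x, h x != -oo%E,
      dom h !=set0,
      lower_semicontinuous h
    & forall (x y : Z) (t : R), 0 <= t <= 1 ->
        (h (t *: x + (1 - t) *: y)%R <= t%:E * h x + (1 - t)%:E * h y)%E].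

Definition diam (S : set Z) : R := sup [set `|u - z| | u in S & z in S].

(* By Motzkin's theorem such a set is closed and convex. *)
Definition has_projection (S : set Z) : Prop :=
  forall w, exists! p, is_argmin S (fun u => 1 / 2 * `|u - w| ^+ 2) p.

Variable ip : {dot Z for idfun}.

Definition is_grad (f : Z -> R) (x g : Z) : Prop :=
  differentiable f x /\ forall u, 'd f x u = ip g u.

Definition grad (f : Z -> R) (x : Z) : Z := xget 0 [set g | is_grad f x g].

Definition C1 (f : Z -> R) : Prop :=
  (forall x, exists g, is_grad f x g) /\ continuous (grad f).

Definition lin (f : Z -> R) (u y : Z) : R := f y + ip (grad f y) (u - y).

Definition curvature (f : Z -> R) (m M : R) (U Y : set Z) : Prop :=
  forall u y, U u -> Y y ->
    - (m / 2) * `|u - y| ^+ 2 <= f u - lin f u y <= M / 2 * `|u - y| ^+ 2.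

Definition lip_grad (f : Z -> R) (L : R) (U Y : set Z) : Prop :=
  forall u y, U u -> Y y -> `|grad f u - grad f y| <= L * `|u - y|.

Definition subdiff (h : Z -> \bar R) (x : Z) : set Z :=
  [set s | forall u, (h x + (ip s (u - x))%:E <= h u)%E].

End Space.

Section Runs.
Context {S T : Type}.

Inductive outcome : Type :=
  | Continue of S
  | Failure
  | Success of T.

(* [iter s o]: [o] is a possible outcome of one complete iteration started in
   state [s].  It is a relation because an argmin may have several values. *)
Variable iter : S -> outcome -> Prop.

(* [returns s r]: some run from [s] stops, with success ([r = Some t], output
   [t]) or with failure ([r = None]). *)
Inductive returns : S -> option T -> Prop :=
  | returns_failure s : iter s Failure -> returns s None
  | returns_success s t : iter s (Success t) -> returns s (Some t)
  | returns_continue s s' r :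
      iter s (Continue s') -> returns s' r -> returns s r.

(* Every run from [s] stops during one of its first [n] iterations, and no
   iteration on the way gets stuck. *)
Fixpoint stops_within (n : nat) (s : S) : Prop :=
  if n is n'.+1 then
    (exists o, iter s o) /\
    forall s', iter s (Continue s') -> stops_within n' s'
  else False.

Fixpoint succeeds_within (n : nat) (s : S) : Prop :=
  if n is n'.+1 then
    [/\ exists o, iter s o, ~ iter s Failure
      & forall s', iter s (Continue s') -> succeeds_within n' s']
  else False.

End Runs.
Arguments outcome : clear implicits.
Arguments Failure {S T}.

Section RACG.
Context {R : realType} {Z : normedModType R}.
Variable ip : {dot Z for idfun}.
Variables (mu M : R) (psis : Z -> R) (psin : Z -> \bar R).

(* [psi] and everything built from it is only used on the domain of [psin],
   where [psin] is finite. *)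
Definition psi (u : Z) : R := psis u + fine (psin u).

Definition Delta (u y v : Z) : R :=
  psi y - psi u - ip v (y - u) + mu / 2 * `|u - y| ^+ 2.

Definition RP (y v yr vr : Z) : Prop :=
  is_argmin setT
    (fun u => ((ip (grad ip psis y - v) u + M / 2 * `|u - y| ^+ 2)%:E
               + psin u)%E) yr /\
  vr = v + M *: (y - yr) + grad ip psis yr - grad ip psis y.

(* [mu < M] because the algorithm divides by [M - mu]. *)
Definition racg_input : Prop :=
  [/\ 0 < mu < M, Conv psin, C1 ip psis
    & forall u y, psis u - lin ip psis u y <= M / 2 * `|u - y| ^+ 2].

(* The data (z_j, z_j^c, B_j, Gamma_j). *)
Record racg_state :=
  RState { rz : Z; rzc : Z; rB : R; rGamma : Z -> R }.

Variables (z0 : Z) (theta : R).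

Definition racg_init : racg_state := RState z0 z0 0 (fun=> 0).

Definition racg_b (s : racg_state) : R :=
  let xi := (1 + mu * rB s) / (M - mu) in
  (xi + Num.sqrt (xi ^+ 2 + 4 * xi * rB s)) / 2.

Definition racg_zt (s : racg_state) : Z :=
  let b := racg_b s in
  let B' := rB s + b in
  (rB s / B') *: rz s + (b / B') *: rzc s.

Definition racg_gammat (s : racg_state) (u : Z) : R :=
  let zt := racg_zt s in
  lin ip psis u zt + fine (psin u) + mu / 2 * `|u - zt| ^+ 2.

Definition racg_gamma (s : racg_state) (z : Z) (u : Z) : R :=
  racg_gammat s z + (M - mu) * ip (racg_zt s - z) (u - z)
  + mu / 2 * `|u - z| ^+ 2.

Definition racg_next (s : racg_state) (z : Z) : racg_state :=
  let b := racg_b s in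
  let B' := rB s + b in
  RState z
    ((1 + mu * B')^-1 *:
       (rzc s - (b * (M - mu)) *: (racg_zt s - z)
        + mu *: (rB s *: rzc s + b *: z)))
    B'
    (fun u => rB s / B' * rGamma s u + b / B' * racg_gamma s z u).

(* The minimizer below is unique, the objective being strongly convex. *)
Definition racg_step (s s' : racg_state) : Prop :=
  let zt := racg_zt s in
  exists z,
    is_argmin setT
      (fun u => ((lin ip psis u zt)%:E + psin u
                 + (M / 2 * `|u - zt| ^+ 2)%:E)%E) z /\
    s' = racg_next s z.

Definition racg_r (s : racg_state) : Z :=
  (rB s)^-1 *: (z0 - rzc s) + mu *: (rz s - rzc s).

Definition racg_eta (s : racg_state) : R :=
  Num.max 0 (psi (rz s) - rGamma s (rzc s) - ip (racg_r s) (rz s - rzc s)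
             + mu / 2 * `|rz s - rzc s| ^+ 2).

Definition racg_check3 (s : racg_state) : Prop :=
  (1 + mu * rB s)^-1 * `|rB s *: racg_r s + rz s - z0| ^+ 2
  + 2 * rB s * racg_eta s <= `|rz s - z0| ^+ 2.

Definition racg_check4 (s : racg_state) : Prop :=
  `|racg_r s| ^+ 2 + 2 * racg_eta s <= theta ^+ 2 * `|rz s - z0| ^+ 2.

Inductive racg_iter (s : racg_state) :
    outcome racg_state (Z * Z * R) -> Prop :=
  | racg_fail3 s' : racg_step s s' -> ~ racg_check3 s' ->
      racg_iter s Failure
  | racg_continue s' : racg_step s s' -> racg_check3 s' -> ~ racg_check4 s' ->
      racg_iter s (Continue s')
  | racg_fail5 s' yr vr : racg_step s s' -> racg_check3 s' -> racg_check4 s' ->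
      RP (rz s') (racg_r s') yr vr ->
      ~ (Delta yr (rz s') (racg_r s') <= racg_eta s') ->
      racg_iter s Failure
  | racg_success s' yr vr :
      racg_step s s' -> racg_check3 s' -> racg_check4 s' ->
      RP (rz s') (racg_r s') yr vr ->
      Delta yr (rz s') (racg_r s') <= racg_eta s' ->
      racg_iter s (Success (rz s', racg_r s', racg_eta s')).

Definition racg : option (Z * Z * R) -> Prop := returns racg_iter racg_init.

End RACG.

Section DAICG.
Context {R : realType} {Z : normedModType R}.
Variable ip : {dot Z for idfun}.
Variables (f1 f2 : Z -> R) (h : Z -> \bar R).

Definition phi (u : Z) : \bar R := ((f1 u + f2 u)%:E + h u)%E.

Definition phi_star : \bar R := ereal_inf (range phi).

(* [d_0] *)
Definition dist_argmin (y0 : Z) : R :=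
  inf [set `|y0 - u| | u in [set u | phi u = phi_star]].

Variables (lambda M2 : R).

Definition da_M : R := lambda * Num.max M2 0 + 1.

Definition da_psis (z0 u : Z) : R :=
  lambda * (lin ip f1 u z0 + f2 u) + 1 / 2 * `|u - z0| ^+ 2.

Definition da_psin (u : Z) : \bar R := (lambda%:E * h u)%E.

Definition SRP (y v z0 yh vh : Z) : Prop :=
  exists vr, RP ip da_M (da_psis z0) da_psin y v yh vr /\
    vh = lambda^-1 *: (vr + z0 - yh) + grad ip f1 yh - grad ip f1 z0.

Variables (Omega : set Z) (theta rho : R).

(* The data (A_k, x_k, y_k). *)
Record da_state := DState { dA : R; dx : Z; dy : Z }.

Definition da_init (y0 : Z) : da_state := DState 0 y0 y0.

Definition da_a (s : da_state) : R := (1 + Num.sqrt (1 + 4 * dA s)) / 2.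

Definition da_xt (s : da_state) : Z :=
  (dA s + da_a s)^-1 *: (dA s *: dy s + da_a s *: dx s).

Definition da_racg (s : da_state) : option (Z * Z * R) -> Prop :=
  racg ip 1 da_M (da_psis (da_xt s)) da_psin (da_xt s) theta.

Definition da_Delta (s : da_state) (u y v : Z) : R :=
  Delta ip 1 (da_psis (da_xt s)) da_psin u y v.

Inductive da_iter (s : da_state) : outcome da_state (Z * Z) -> Prop :=
  | da_fail2 : da_racg s None -> da_iter s Failure
  | da_fail3 ya v eps : da_racg s (Some (ya, v, eps)) ->
      ~ (da_Delta s (dy s) ya v <= eps) -> da_iter s Failure
  | da_success ya v eps yh vh : da_racg s (Some (ya, v, eps)) ->
      da_Delta s (dy s) ya v <= eps ->
      SRP ya v (da_xt s) yh vh -> `|vh| <= rho ->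
      da_iter s (Success (yh, vh))
  | da_continue ya v eps yh vh x y : da_racg s (Some (ya, v, eps)) ->
      da_Delta s (dy s) ya v <= eps ->
      SRP ya v (da_xt s) yh vh -> ~ (`|vh| <= rho) ->
      is_argmin Omega
        (fun u => 1 / 2 * `|u - (dx s - da_a s *: (v + da_xt s - ya))| ^+ 2)
        x ->
      is_argmin [set dy s; ya] phi y ->
      da_iter s (Continue (DState (dA s + da_a s) x y)).

End DAICG.

Section Constants.
Context {R : realType}.
Variables (lambda theta m1 M1 m2 M2 : R).

Definition Lip (m M : R) : R := Num.max `|m| `|M|.

Definition Cbar : R :=
  (1 + lambda * (Num.max M2 0 + Lip m1 M1 + Lip m2 M2))
  / Num.sqrt (1 + lambda * Num.max M2 0).

Definition Econst : R :=
  Num.sqrt lambda * Lip m1 M1 + (1 + theta * Cbar) / Num.sqrt lambda.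

End Constants.

(* Main.v *)
(** Write [y], [v], [eps] for the output of R-ACG at [zt], and let [gbar] be the
    affine function
    [psi y - eps + <v, . - y> + |. - y|^2 / 2 - |. - zt|^2 / 2].
    A test [Delta_1(u; y, v) <= eps] says that
    [gbar u <= lambda phi(u) + lambda m1^+ |u - zt|^2 / 2].
    Since [gbar] is affine, the projection inequality gives, for all [u] in [Omega],
    [A_k (lambda phi(y_k) + |y - zt|^2 / 4) + |u - x_k|^2 / 2
       <= A_(k-1) gbar(y_(k-1)) + a_(k-1) gbar(u) + |u - x_(k-1)|^2 / 2].
    As long as the method does not stop, [|y - zt|] stays above
    [rho sqrt(lambda) / (2 E)], so every iteration gains a fixed amount.  Part (a)
    takes [u = y_(k-1)], the only point where the method tests [gbar], and sums over
    the second half of the iterations, in which the errors [D_Omega^2 / A_k] are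
    small.  For (c), convexity of [f2] makes the estimate-sequence invariants of
    R-ACG hold, so that it never fails and the test holds at every [u] in [dom h];
    with [u] a minimizer of [phi] the estimates telescope. *)
Require Import Defs.
From HB Require Import structures.
From mathcomp Require Import all_boot all_order all_algebra.
From mathcomp Require Import all_classical all_reals all_analysis.
From mathcomp Require Import ring lra.

Set Implicit Arguments.
Unset Strict Implicit.
Unset Printing Implicit Defensive.

Import Order.TTheory GRing.Theory Num.Theory.
Import numFieldNormedType.Exports.

Local Open Scope classical_set_scope.
Local Open Scope ring_scope.

(** * Inner product spaces *)

(** Two obstacles shape the proof. The points [zt] lie in [Omega], in general outside [dom h]; their
    membership and the projection inequality both need [Omega] convex, while only unique nearest
    points are assumed. Hence Motzkin's theorem. Without convexity of [f2] the invariants of R-ACG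
    may break, and only its tests can be used: [|v|^2 + 2 eps <= theta^2 |y - zt|^2] and
    [lambda M1 + theta^2 <= 1/2] together leave the gain [|y - zt|^2 / 4]; and the test of step 3
    implies that of step 4 once [B_j] is large, so that R-ACG always stops. The relation
    [a_(k-1)^2 = A_k] does two jobs: it gives [k^2 / 4 <= A_k <= k^2], and it gives [A_k |y_(k-1) -
    zt|^2 = |y_(k-1) - x_(k-1)|^2], so that the error due to [m1^+] at [y_(k-1)] does not grow with
    [A_k]. In (c) the gains add up to order [k^3], against errors of order [k D_Omega^2] and
    [k^2 D_h^2] and an initial distance [d_0^2]; this is where the exponents 2/3 come from. *)

Section InnerProduct.
Context {R : realType} {Z : normedModType R} (ip : {dot Z for idfun}).
Hypothesis ip_norm : forall x, `|x| = Num.sqrt (ip x x).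

Lemma ipC x y : ip x y = ip y x.
Proof. by rewrite hermitian_subproof expr0 mul1r. Qed.

Lemma ipDl x y z : ip (x + y) z = ip x z + ip y z.
Proof. exact: linearDl. Qed.

Lemma ipZl a x z : ip (a *: x) z = a * ip x z.
Proof. by rewrite linearZl_LR. Qed.

Lemma ipDr x y z : ip z (x + y) = ip z x + ip z y.
Proof. by rewrite ipC ipDl !(ipC z). Qed.

Lemma ipZr a x z : ip z (a *: x) = a * ip z x.
Proof. by rewrite ipC ipZl (ipC z). Qed.

Lemma ipNl x z : ip (- x) z = - ip x z.
Proof. by rewrite -scaleN1r ipZl mulN1r. Qed.

Lemma ipNr x z : ip z (- x) = - ip z x.
Proof. by rewrite ipC ipNl (ipC z). Qed.

Lemma ip0l z : ip 0 z = 0.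
Proof. by rewrite -(scale0r 0) ipZl mul0r. Qed.

Lemma ip0r z : ip z 0 = 0.
Proof. by rewrite ipC ip0l. Qed.

Definition ipE := (ipDl, ipDr, ipNl, ipNr, ipZl, ipZr).

Lemma ip_ge0 x : 0 <= ip x x.
Proof.
have [->|x0] := eqVneq x 0; first by rewrite ip0l.
exact/ltW/neq0_dnorm_gt0.
Qed.

Lemma sqr_norm x : `|x| ^+ 2 = ip x x.
Proof. by rewrite ip_norm sqr_sqrtr// ip_ge0. Qed.

Lemma ip_inj x y : (forall w, ip x w = ip y w) -> x = y.
Proof.
move=> H; apply/eqP; rewrite -subr_eq0 -normr_eq0 -sqrf_eq0 sqr_norm.
by rewrite ipDl ipNl H subrr.
Qed.

Lemma norm_ip_le x y : `|ip x y| <= `|x| * `|y|.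
Proof.
have [->|y0] := eqVneq y 0; first by rewrite ip0r !normr0 mulr0.
rewrite -(ler_pXn2r (n := 2))// ?nnegrE ?mulr_ge0//.
rewrite exprMn real_normK ?num_real// !sqr_norm.
have yy : 0 < ip y y by exact: neq0_dnorm_gt0.
have := ip_ge0 (ip y y *: x - ip x y *: y).
rewrite !ipE (ipC y x) => H.
rewrite -subr_ge0 -(pmulr_rge0 _ yy).
by apply: (le_trans H); rewrite le_eqVlt; apply/orP; left; apply/eqP; ring.
Qed.

Lemma ip_le x y : ip x y <= `|x| * `|y|.
Proof. exact: le_trans (ler_norm _) (norm_ip_le _ _). Qed.

Lemma continuous_ip x : continuous (ip x : Z -> R).
Proof.
move=> y; apply/cvgrPdist_le => /= e e0.
near=> z.
rewrite -ipNr -ipDr (le_trans (norm_ip_le _ _))//.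
have x1 : 0 < `|x| + 1 by rewrite ltr_wpDl.
apply: (@le_trans _ _ ((`|x| + 1) * `|y - z|)).
  by rewrite ler_wpM2r// lerDl.
rewrite -ler_pdivlMl// mulrC.
near: z; apply: cvgr_dist_le => //; exact: mulr_gt0 e0 _.
Unshelve. all: by end_near.
Qed.

End InnerProduct.

Lemma sqr_normZ (R : realType) (Z : normedModType R) (a : R) (x : Z) :
  `|a *: x| ^+ 2 = a ^+ 2 * `|x| ^+ 2.
Proof. by rewrite normrZ exprMn real_normK ?num_real. Qed.

Section NormIdentities.
Context {R : realType} {Z : normedModType R} (ip : {dot Z for idfun}).
Hypothesis ip_norm : forall x, `|x| = Num.sqrt (ip x x).

Lemma sqr_normD (x y : Z) : `|x + y| ^+ 2 = `|x| ^+ 2 + 2 * ip x y + `|y| ^+ 2.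
Proof. by rewrite !(sqr_norm ip_norm) !ipE (ipC ip y x); ring. Qed.

Lemma sqr_norm_conv (t : R) (x y : Z) :
  `|t *: x + (1 - t) *: y| ^+ 2
  = t * `|x| ^+ 2 + (1 - t) * `|y| ^+ 2 - t * (1 - t) * `|x - y| ^+ 2.
Proof. by rewrite !(sqr_norm ip_norm) !ipE (ipC ip y x); ring. Qed.

End NormIdentities.

(** * Minimization of lower semicontinuous functions; compactness *)

Section SemicontinuousMin.
Context {R : realType} {X : topologicalType}.
Implicit Types (F : X -> \bar R) (q : X -> R) (K : set X).

Lemma ereal_real_between (x y : \bar R) :
  (x < y)%E -> exists a : R, (x < a%:E)%E /\ (a%:E < y)%E.
Proof.
move=> xy; case: x y xy => [x| |] [y| |] //= xy.
- exists ((x + y) / 2); rewrite !lte_fin in xy *; split; lra.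
- by exists (x + 1); rewrite lte_fin ltry; split => //; lra.
- by exists (y - 1); rewrite lte_fin ltNyr; split => //; lra.
- by exists 0; rewrite ltNyr ltry.
Qed.

(** If no point were minimal, the sublevel sets at the values taken on [K] would generate a proper
    filter. At a cluster point [p], semicontinuity keeps [F] above a real number between some
    [F y < F p] and [F p], against the sublevel set of [y]. *)
Lemma lsc_compact_min F K : compact K -> K !=set0 -> lower_semicontinuous F ->
  exists x, is_argmin K F x.
Proof.
move=> cK [k0 Kk0] lF; apply: contrapT => noarg.
have lower x : K x -> exists2 y, K y & (F y < F x)%E.
  move=> Kx; apply: contrapT => H; apply: noarg; exists x; split=> // y Ky.
  by rewrite leNgt; apply/negP => ?; apply: H; exists y.
pose G := filter_from K (fun y => [set x | K x /\ (F x <= F y)%E]).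
have FG : ProperFilter G.
  apply: filter_from_proper; last by move=> y Ky; exists y.
  apply: filter_from_filter; first by exists k0.
  move=> y z Ky Kz; case: (leP (F y) (F z)) => yz.
  - by exists y => // x [Kx xy]; do !split => //; exact: le_trans xy yz.
  - exists z => // x [Kx xy]; do !split => //; exact: le_trans xy (ltW yz).
have GK : G K by exists k0 => // x [].
have [p [Kp clp]] := cK G FG GK.
have [y Ky yp] := lower p Kp.
have [a [ya ap]] := ereal_real_between yp.
have [V Vp Va] := lF p a ap.
have Gy : G [set x | K x /\ (F x <= F y)%E] by exists y.
have [x [[_ xy] Vx]] := clp _ _ Gy Vp.
by have := lt_le_trans (lt_trans ya (Va x Vx)) xy; rewrite ltxx.
Qed.

Lemma lsc_addl q F : continuous q -> lower_semicontinuous F ->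
  lower_semicontinuous (fun x => (q x)%:E + F x)%E.
Proof.
move=> cq lF x a axF.
have /ereal_real_between [b [ab bF]] : ((a - q x)%:E < F x)%E.
  by rewrite EFinB lteBlDl.
have [V Vx Vb] := lF x b bF.
rewrite lte_fin in ab.
exists (V `&` [set y | `|q x - q y| < b - (a - q x)]).
  apply: filterI => //.
  have /cvgrPdist_lt /(_ (b - (a - q x))) := cq x.
  by apply; rewrite subr_gt0.
move=> y [Vy /ltr_normlP [_ qy]].
rewrite -lteBlDl// -EFinB; apply: lt_trans (Vb y Vy).
rewrite lte_fin; lra.
Qed.

End SemicontinuousMin.

Section FiniteDimension.
Context {R : realType} {Z : normedModType R} (ip : {dot Z for idfun}).
Hypothesis ip_norm : forall x, `|x| = Num.sqrt (ip x x).

Let proj (s : seq Z) x : Z := \sum_(e <- s) ip x e *: e.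

Let projD s x y : proj s (x + y) = proj s x + proj s y.
Proof.
by rewrite /proj -big_split; apply: eq_bigr => e _; rewrite ipDl scalerDl.
Qed.

Let projZ s a x : proj s (a *: x) = a *: proj s x.
Proof.
by rewrite /proj scaler_sumr; apply: eq_bigr => e _; rewrite ipZl scalerA.
Qed.

Let proj_sum s n (c : 'I_n -> R) (e : 'I_n -> Z) :
  proj s (\sum_i c i *: e i) = \sum_i c i *: proj s (e i).
Proof.
elim/big_rec2: _ => [|i y x _ <-]; last by rewrite projD projZ.
by rewrite /proj big1// => e' _; rewrite ip0l scale0r.
Qed.

(* Gram-Schmidt; being self-adjoint idempotent is the only property of the
   projection on the span of [s] that the induction needs. *)
Let gram_schmidt (l : seq Z) : exists s : seq Z,
  (forall x y, ip (x - proj s x) (proj s y) = 0) /\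
  (forall e, e \in l -> proj s e = e).
Proof.
elim: l => [|a l [s [orth sl]]].
  by exists [::]; split=> // x y; rewrite /proj !big_nil ip0r.
have [pa|pa] := eqVneq (proj s a) a.
  exists s; split=> // e; rewrite inE => /orP [/eqP ->//|]; exact: sl.
pose d := a - proj s a; pose w := `|d|^-1 *: d.
have d0 : 0 < `|d| by rewrite normr_gt0 subr_eq0 eq_sym.
have ww : ip w w = 1.
  by rewrite -sqr_norm// normrZ normfV normr_id mulVf ?expr1n// gt_eqF.
have wp y : ip w (proj s y) = 0 by rewrite ipZl orth mulr0.
have wd : `|d| *: w = d by rewrite /w scalerA mulfV ?scale1r// gt_eqF.
clearbody w.
have pE x : proj (w :: s) x = ip x w *: w + proj s x by rewrite /proj big_cons.
have pw x : ip (proj s x) w = 0 by rewrite ipC.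
exists (w :: s); split.
  move=> x y; rewrite !pE.
  move: (orth x y); rewrite !ipE !wp !pw ww => /eqP.
  rewrite subr_eq0 => /eqP ->; ring.
move=> e; rewrite inE => /orP [/eqP ->|el].
  have aw : ip a w = `|d|.
    by rewrite -(subrK (proj s a) a) -/d ipDl pw addr0 -{1}wd ipZl ww mulr1.
  by rewrite pE aw wd /d subrK.
by rewrite pE -(sl e el) (ipC ip (proj s e)) wp scale0r add0r !sl.
Qed.

Hypothesis fin_dim : exists (n : nat) (e : 'I_n -> Z),
  forall x, exists c : 'I_n -> R, x = \sum_(i < n) c i *: e i.

Lemma exists_dual_basis : exists (n : nat) (e : 'I_n -> Z),
  forall x, x = \sum_(i < n) ip x (e i) *: e i.
Proof.
have [n [e ex]] := fin_dim.
have [s [_ se]] := gram_schmidt (map e (enum 'I_n)).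
exists (size s), (fun i => nth 0 s i) => x.
rewrite -(big_mkord xpredT (fun i => ip x (nth 0 s i) *: nth 0 s i)).
rewrite -(big_nth 0 xpredT (fun v => ip x v *: v)) -/(proj s x).
have [c {1 2}->] := ex x; rewrite proj_sum.
apply: eq_bigr => i _; rewrite se//.
by apply: map_f; rewrite mem_enum.
Qed.

(** Compactness is imported from row vectors: by Cauchy-Schwarz the coordinates [ip x (e i)] are at
    most [r * |e i|], so [K] is the continuous image of a closed part of a box. *)
Lemma closed_bounded_compact (K : set Z) : closed K -> bounded_set K -> compact K.
Proof.
move=> clK /ex_strict_bound_gt0 [r r0 Kr].
have [n [e eE]] := exists_dual_basis.
pose f (v : 'rV[R]_n) : Z := \sum_(i < n) v ord0 i *: e i.
have cf : continuous f.
  rewrite /f; elim: (index_enum _) => [|i l IH].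
    rewrite [f in continuous f](_ : _ = fun=> 0); first exact: cst_continuous.
    by apply/funext => v; rewrite big_nil.
  rewrite [f in continuous f](_ : _ = fun v : 'rV[R]_n =>
    v ord0 i *: e i + \sum_(j <- l) v ord0 j *: e j); last first.
    by apply/funext => v; rewrite big_cons.
  move=> v.
  apply: (@cvgD R Z _ (nbhs v) _ (fun u : 'rV[R]_n => u ord0 i *: e i)); last exact: IH.
  by apply: cvgZr_tmp; exact: coord_continuous.
pose box := [set v : 'rV[R]_n | forall i,
  [set x | x \in `[- (r * `|e i|), r * `|e i|]] (v ord0 i)].
have cbox : compact box.
  apply: (@rV_compact R n (fun i => [set x | x \in `[- (r * `|e i|), r * `|e i|]])).
  move=> i; exact: segment_compact.
have clf : closed (f @^-1` K) by apply: closed_comp.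
have -> : K = f @` (box `&` (f @^-1` K)).
  apply/seteqP; split=> [x Kx|_ [v [_ ?] <-]//].
  have fx : f (\row_i ip x (e i)) = x.
    by rewrite {2}(eE x); apply: eq_bigr => i _; rewrite mxE.
  exists (\row_i ip x (e i)) => //; split=> [i|]; last by rewrite /= fx.
  rewrite /= mxE in_itv /= -ler_norml (le_trans (norm_ip_le ip_norm _ _))//.
  by rewrite ler_wpM2r// ltW//; exact: Kr.
apply: continuous_compact; first exact: continuous_subspaceT.
exact: compact_closedI.
Qed.

End FiniteDimension.

(** * Motzkin's theorem *)

(** Stands in for limits: an optimality condition follows by moving a fraction [d] along a segment,
    dividing by [d] and bounding the second-order term by [d * c]. *)
Lemma le_vanishing (R : realType) (a b c : R) : 0 <= c ->
  (forall d, 0 < d <= 1 -> a <= b + d * c) -> a <= b.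
Proof.
move=> c0 H; apply/ler_addgt0Pr => e e0.
have c1 : 0 < c + 1 by lra.
pose d := Num.min 1 (e / (c + 1)).
have d1 : 0 < d <= 1 by rewrite lt_min ltr01 divr_gt0//= ge_min lexx.
apply: le_trans (H d d1) _; rewrite lerD2l.
apply: (@le_trans _ _ (e / (c + 1) * c)).
  by rewrite ler_wpM2r// ge_min lexx orbT.
rewrite mulrAC ler_pdivrMr// ler_wpM2l ?(ltW e0)//; lra.
Qed.

Section Motzkin.
Context {R : realType} {Z : normedModType R} (ip : {dot Z for idfun}).
Hypothesis fdip : fin_dim_inner_product ip.
Variable Omega : set Z.
Hypothesis Omega_proj : has_projection Omega.

Let ip_norm : forall x, `|x| = Num.sqrt (ip x x) := fdip.1.

Let nearest w : exists p, [/\ Omega p, forall u, Omega u -> `|p - w| <= `|u - w|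
  & forall p', Omega p' -> (forall u, Omega u -> `|p' - w| <= `|u - w|) -> p' = p].
Proof.
have le_sq (u v : Z) : (1 / 2 * `|u - w| ^+ 2 <= 1 / 2 * `|v - w| ^+ 2) =
    (`|u - w| <= `|v - w|).
  by rewrite ler_pM2l ?ler_pXn2r ?nnegrE//; lra.
have [p [[Op pmin] puniq]] := Omega_proj w.
exists p; split=> // [u Ou|p' Op' p'min].
  by have /= := pmin u Ou; rewrite [(_ <= _)%O]le_sq.
apply/esym/puniq; split=> // u Ou /=.
by rewrite [(_ <= _)%O]le_sq; exact: p'min.
Qed.

Lemma has_projection_closed : closed Omega.
Proof.
move=> x clx; have [p [Op pmin _]] := nearest x.
suff : `|p - x| <= 0 by rewrite normr_le0 subr_eq0 => /eqP <-.
apply: (@le_vanishing _ _ _ 1) => // d /andP[d0 _].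
have [u [Ou]] := clx _ (nbhsx_ballx x d d0).
rewrite -ball_normE /= distrC => ud.
by rewrite add0r mulr1 (le_trans (pmin u Ou))// ltW.
Qed.

Hypothesis Omega_bounded : bounded_set Omega.

(* Asplund's function [g w = max_(u in Omega) (<w, u> - |u|^2 / 2)] is convex
   with gradient the projection [p].  A minimizer [w] of
   [g - <., xb> + e / 2 |.|^2] satisfies [p w = xb - e w], so that the points
   [xb - e w] of [Omega] converge to [xb] as [e] vanishes. *)
Lemma has_projection_convex x y (t : R) : Omega x -> Omega y -> 0 <= t <= 1 ->
  Omega (t *: x + (1 - t) *: y).
Proof.
move=> Ox Oy /andP[t0 t1].
have [p pP] := choice nearest.
have Op w : Omega (p w) by have [] := pP w.
have pmin w u : Omega u -> `|p w - w| <= `|u - w| by have [_ + _] := pP w; exact.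
(* [a w u] equals [|w|^2 / 2 - |u - w|^2 / 2], so the nearest point to [w] maximizes [a w] over
   [Omega]. *)
pose a w u := ip w u - `|u| ^+ 2 / 2.
have amax w u : Omega u -> a w u <= a w (p w).
  move=> /(pmin w); rewrite -(ler_pXn2r (n := 2)) ?nnegrE// /a.
  by rewrite !(sqr_norm ip_norm) !ipE !(ipC ip _ w); lra.
set xb := t *: x + (1 - t) *: y.
pose c := (t * `|x| ^+ 2 + (1 - t) * `|y| ^+ 2) / 2.
have t1' : 0 <= 1 - t by lra.
have c0 : 0 <= c by rewrite divr_ge0// addr_ge0// mulr_ge0// exprn_ge0.
have ac w : ip w xb - c <= a w (p w).
  have := ler_wpM2l t0 (amax w x Ox); have := ler_wpM2l t1' (amax w y Oy).
  by rewrite /a /xb /c !ipE; lra.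
clearbody xb.
suff step e : 0 < e -> `|p xb - xb| ^+ 2 <= e * (2 * c).
  have : `|p xb - xb| ^+ 2 <= 0.
    apply: (@le_vanishing _ _ _ (2 * c)) => [|d /andP[/step + _]]; last by rewrite add0r.
    by rewrite mulr_ge0.
  rewrite le_eqVlt ltNge exprn_ge0// orbF sqrf_eq0 normr_eq0 subr_eq0.
  by move=> /eqP <-.
move=> e0.
pose G w := a w (p w) - ip w xb + e / 2 * `|w| ^+ 2.
have Gge w : e / 2 * `|w| ^+ 2 - c <= G w by have := ac w; rewrite /G; lra.
have G0 : G 0 <= 0.
  rewrite /G /a !ip0l normr0 expr0n /= mulr0 subr0 addr0 sub0r oppr_le0.
  by rewrite divr_ge0// exprn_ge0.
(* Beyond radius [r] the lower bound [Gge] is nonnegative, hence at least [G 0]; a minimizer over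
   the ball is therefore global. *)
pose r := 1 + 2 * c / e.
have ce0 : 0 <= 2 * c / e by apply: divr_ge0; [exact: mulr_ge0|exact: ltW].
have r1 : 1 <= r by rewrite lerDl.
have [w [_ wmin]] : exists w, is_argmin (closed_ball_ Num.norm (0 : Z) r) (EFin \o G) w.
  apply: lsc_compact_min.
  - apply: (closed_bounded_compact ip_norm fdip.2).
      exact: closed_closed_ball_.
    by exists r; split; [exact: num_real|] => s rs z /=;
      rewrite /closed_ball_ /= sub0r normrN => /le_trans; apply; exact: ltW.
  - by exists 0; rewrite /closed_ball_ /= subrr normr0; lra.
  - move=> z s; rewrite /= lte_fin => sG.
    (* Freezing the maximizer at [p z] gives a continuous minorant of [G] that meets it at [z];
       semicontinuity of [G] follows. *)
    pose H w := ip (p z) w - `|p z| ^+ 2 / 2 - ip xb w + e / 2 * `|w| ^+ 2.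
    have HG u : H u <= G u.
      have := amax u (p z) (Op z); rewrite /G /H /a.
      by rewrite (ipC ip u (p z)) (ipC ip u xb); lra.
    have cH : H u @[u --> z] --> H z.
      apply: (@cvgD R R^o _ (nbhs z) _
        (fun u => ip (p z) u - `|p z| ^+ 2 / 2 - ip xb u)); last first.
        apply: (@cvgMl_tmp R _ (nbhs z) _ (fun u : Z => `|u| ^+ 2)).
        apply: (@cvg_comp _ _ _ Num.norm (fun u : R => u ^+ 2)).
          exact: norm_continuous.
        exact: exprn_continuous.
      apply: (@cvgB R R^o _ (nbhs z) _ (fun u => ip (p z) u - `|p z| ^+ 2 / 2)).
        apply: (@cvgB R R^o _ (nbhs z) _ (ip (p z))); last exact: cvg_cst.
        exact: continuous_ip.
      exact: continuous_ip.
    have HGz : H z = G z.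
      rewrite /G /H /a (ipC ip z (p z)) (ipC ip z xb); ring.
    exists [set u | s < H u]; last by move=> u /= su; rewrite lte_fin (lt_le_trans su).
    by apply: (cvgr_gt (H z)); rewrite // HGz.
have Gw u : G w <= G u.
  have [ur|ur] := leP `|u| r.
    by have := wmin u; rewrite /closed_ball_ /= sub0r normrN lee_fin; exact.
  apply: (@le_trans _ _ 0).
    have := wmin 0; rewrite /closed_ball_ /= subrr normr0 lee_fin.
    by move=> /(_ _)/le_trans; apply => //; lra.
  apply: le_trans (Gge u); rewrite subr_ge0.
  have ru : r <= `|u| ^+ 2.
    apply: le_trans (ltW ur) _; rewrite expr2 ler_peMl//; lra.
  have -> : c = e / 2 * (2 * c / e) by field; rewrite gt_eqF.
  by rewrite ler_pM2l ?divr_gt0//; move: ru; rewrite /r; lra.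
(* [q] is the expected gradient of [G] at [w], to be shown zero. In place of differentiability,
   [slope] compares [w] with [w - s q], using [p (w - s q)] in the maximum that defines [G w]. *)
have [q qE] : exists q, q = p w - xb + e *: w by exists (p w - xb + e *: w).
have slope s : 0 < s -> ip q (p (w - s *: q) - xb + e *: w) <= s * (e / 2 * `|q| ^+ 2).
  move=> s0; rewrite -subr_ge0 -(pmulr_rge0 _ s0).
  have := Gw (w - s *: q); have := amax w _ (Op (w - s *: q)).
  rewrite /G /a !(sqr_norm ip_norm) !ipE !(ipC ip w q) !(ipC ip w xb).
  by lra.
(* The projection is not known to be continuous. Compactness of [Omega] gives a cluster point of
   [p (w - s q)], which turns out nearest to [w] and hence equal to [p w]. *)
have [us [_ clu]] : (Omega `&` cluster ((p \o (fun s => w - s *: q)) @ 0^'+)) !=set0.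
  apply: (closed_bounded_compact ip_norm fdip.2 has_projection_closed Omega_bounded).
  by apply: (@filterE _ 0^'+) => s; exact: Op.
have approx d : 0 < d -> exists2 s, 0 < s < d & `|us - p (w - s *: q)| < d.
  move=> d0.
  have nd : ((p \o (fun s => w - s *: q)) @ 0^'+)
      [set p (w - s *: q) | s in [set s | 0 < s < d]].
    change (\forall s \near 0^'+, [set p (w - s *: q) | s in [set s | 0 < s < d]]
      (p (w - s *: q))).
    near=> s; exists s => //=; apply/andP; split; near: s.
      exact: nbhs_right_gt.
    exact: nbhs_right_lt.
  have [_ [[s sd <-]]] := clu _ _ nd (nbhsx_ballx us d d0).
  by rewrite -ball_normE /= => ?; exists s.
have qn : 0 <= `|q| by [].
have usE : us = p w.
  have [_ _] := pP w; apply=> [|u Ou].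
    apply: has_projection_closed => V /nbhs_ballP [d /= d0 dV].
    have [s _ sd] := approx d d0.
    by exists (p (w - s *: q)); split => //; apply: dV; rewrite -ball_normE.
  apply: (@le_vanishing _ _ _ (1 + 2 * `|q|)) => [|d /andP[d0 _]]; first lra.
  have [s /andP[s0 sd] sp] := approx d d0.
  have h1 : `|us - w| <= `|us - p (w - s *: q)| + `|p (w - s *: q) - w|.
    by rewrite (le_trans _ (ler_normD _ _))// addrA subrK.
  have sq : `|s *: q| <= d * `|q| by rewrite normrZ gtr0_norm// ler_wpM2r// ltW.
  have h2 : `|p (w - s *: q) - w| <= `|p (w - s *: q) - (w - s *: q)| + `|s *: q|.
    have -> : p (w - s *: q) - w = p (w - s *: q) - (w - s *: q) - s *: q.
      by rewrite opprB [in RHS]addrA [in RHS]addrAC addrK.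
    exact: ler_normB.
  have h3 := pmin (w - s *: q) u Ou.
  have h4 : `|u - (w - s *: q)| <= `|u - w| + `|s *: q|.
    by rewrite opprB addrA addrAC; exact: ler_normD.
  by lra.
have q0 : q = 0.
  suff : `|q| ^+ 2 <= 0.
    by rewrite le_eqVlt ltNge exprn_ge0// orbF sqrf_eq0 normr_eq0 => /eqP.
  apply: (@le_vanishing _ _ _ (`|q| + e / 2 * `|q| ^+ 2)) => [|d /andP[d0 _]].
    by rewrite addr_ge0// mulr_ge0 ?exprn_ge0// divr_ge0// ltW.
  have [s /andP[s0 sd] sp] := approx d d0.
  have h1 := slope s s0.
  have h2 := ip_le ip_norm q (us - p (w - s *: q)).
  have h3 : `|q| * `|us - p (w - s *: q)| <= d * `|q| by rewrite mulrC ler_wpM2r// ltW.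
  have h4 : s * (e / 2 * `|q| ^+ 2) <= d * (e / 2 * `|q| ^+ 2).
    by rewrite ler_wpM2r ?(ltW sd)// mulr_ge0 ?exprn_ge0// divr_ge0// ltW.
  have qq : `|q| ^+ 2 = ip q (us - p (w - s *: q)) + ip q (p (w - s *: q) - xb + e *: w).
    by rewrite (sqr_norm ip_norm) -ipDr usE addrA addrA subrK -qE.
  lra.
have ew : `|e *: w| ^+ 2 <= e * (2 * c).
  have wc : e / 2 * `|w| ^+ 2 <= c by have := Gge w; have := le_trans (Gw 0) G0; lra.
  have := ler_wpM2l (ltW e0) wc; rewrite normrZ exprMn (gtr0_norm e0); lra.
apply: le_trans ew; rewrite ler_pXn2r ?nnegrE//.
have -> : e *: w = - (p w - xb) by apply/eqP; rewrite -addr_eq0 addrC -qE q0.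
by rewrite normrN; exact: pmin.
Unshelve. all: by end_near.
Qed.

End Motzkin.

(** * Gradients and convexity *)

Section Gradient.
Context {R : realType} {Z : normedModType R} (ip : {dot Z for idfun}).
Hypothesis ip_norm : forall x, `|x| = Num.sqrt (ip x x).
Implicit Types (f : Z -> R) (x v g : Z).

Lemma C1_is_grad f x : C1 ip f -> is_grad ip f x (grad ip f x).
Proof. by move=> [/(_ x) [g gP] _]; rewrite /grad; case: xgetP => [y -> //|/(_ g)]. Qed.

Lemma C1_continuous f : C1 ip f -> continuous f.
Proof. by move=> f1 x; have [/differentiable_continuous] := C1_is_grad x f1. Qed.

Lemma cvg_grad f x v : C1 ip f ->
  t^-1 * (f (t *: v + x) - f x) @[t --> 0^'] --> ip (grad ip f x) v.
Proof.
move=> f1; have [df <-] := C1_is_grad x f1.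
rewrite -deriveE//; exact: (diff_derivable df).
Qed.

Lemma gradP f x g : C1 ip f ->
  (forall v, t^-1 * (f (t *: v + x) - f x) @[t --> 0^'] --> ip g v) ->
  grad ip f x = g.
Proof.
move=> f1 fg; apply/eqP; rewrite -subr_eq0 -normr_eq0 -sqrf_eq0 (sqr_norm ip_norm).
rewrite ipDl ipNl subr_eq0; apply/eqP.
exact: (cvg_unique _ (cvg_grad (v := _) f1) (fg _)).
Qed.

Lemma convex_grad_le f x y : C1 ip f ->
  convex_function (setT : set (convex_lmodType Z)) f ->
  f x + ip (grad ip f x) (y - x) <= f y.
Proof.
move=> f1 cf; rewrite -lerBrDl.
have cvg := cvg_dnbhs_at_right (cvg_grad (v := y - x) (x := x) f1).
apply: (cvgr_to_le cvg); near=> t.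
have t0 : 0 < t by near: t; exact: nbhs_right_gt.
have t1 : t <= 1 by near: t; apply: nbhs_right_le.
rewrite ler_pdivrMl//.
have := cf (Itv01 (ltW t0) t1) y x; rewrite !in_setT => /(_ isT isT).
rewrite convRE /= /unstable.onem.
have -> : conv (Itv01 (ltW t0) t1) (y : convex_lmodType Z) x = t *: (y - x) + x.
  by rewrite /conv /= /unstable.onem scalerBr scalerBl scale1r addrA addrAC.
lra.
Unshelve. all: by end_near.
Qed.

End Gradient.

Section ConvexFunction.
Context {R : realType} {Z : normedModType R}.
Variable h : Z -> \bar R.
Hypothesis ch : Conv h.

Lemma Conv_fineK x : dom h x -> h x = (fine (h x))%:E.
Proof.
have [hN _ _ _] := ch.
by rewrite /dom /= => hx; rewrite fineK// fin_numE hN lt_eqF.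
Qed.

Lemma Conv_fine x y (t : R) : dom h x -> dom h y -> 0 <= t <= 1 ->
  dom h (t *: x + (1 - t) *: y) /\
  fine (h (t *: x + (1 - t) *: y)) <= t * fine (h x) + (1 - t) * fine (h y).
Proof.
move=> hx hy t01; have [_ _ _ /(_ x y t t01)] := ch.
rewrite (Conv_fineK hx) (Conv_fineK hy) -!EFinM -EFinD => H.
have hz : dom h (t *: x + (1 - t) *: y) by exact: le_lt_trans H (ltry _).
by split=> //; move: H; rewrite (Conv_fineK hz) lee_fin.
Qed.

Lemma dom_notin x : ~ dom h x -> h x = +oo%E.
Proof. by rewrite /dom /=; case: (h x) => [r||] //; rewrite ?ltry ?ltNyr. Qed.

Lemma argmin_add_dom (q : Z -> R) z :
  is_argmin setT (fun u => ((q u)%:E + h u)%E) z <->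
  dom h z /\ forall u, dom h u -> q z + fine (h z) <= q u + fine (h u).
Proof.
split=> [[_ zmin]|[hz zmin]].
  have hz : dom h z.
    have [_ [x hx] _ _] := ch; have := zmin x I.
    rewrite (Conv_fineK hx) -EFinD => /le_lt_trans /(_ (ltry _)).
    by rewrite /dom /=; case: (h z) => [r _||_]; rewrite ?ltry ?ltNyr// addey.
  split=> // u hu; have := zmin u I.
  by rewrite (Conv_fineK hz) (Conv_fineK hu) -!EFinD lee_fin.
split=> // u _; have [hu|/dom_notin ->] := pselect (dom h u).
  by rewrite (Conv_fineK hz) (Conv_fineK hu) -!EFinD lee_fin zmin.
by rewrite addey// leey.
Qed.

Lemma argmin_add_exists (q : Z -> R) : compact (dom h) -> continuous q ->
  exists z, is_argmin setT (fun u => ((q u)%:E + h u)%E) z.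
Proof.
move=> ck cq; have [_ h0 lh _] := ch.
have [z [hz zmin]] := lsc_compact_min ck h0 (lsc_addl cq lh).
exists z; apply/argmin_add_dom; split=> // u hu; have := zmin u hu.
by rewrite (Conv_fineK hz) (Conv_fineK hu) -!EFinD lee_fin.
Qed.

Variable ip : {dot Z for idfun}.
Hypothesis ip_norm : forall x, `|x| = Num.sqrt (ip x x).

(** Compare [z] with [z + t (u - z)], divide by [t] and let [t] vanish: the square contributes its
    derivative and an error [t M / 2 |u - z|^2]. *)
Lemma argmin_quad_subgradient (a y z : Z) (k M : R) : 0 <= M ->
  is_argmin setT (fun u => ((k + ip a u + M / 2 * `|u - y| ^+ 2)%:E + h u)%E) z ->
  dom h z /\
  forall u, dom h u -> fine (h z) - ip (a + M *: (z - y)) (u - z) <= fine (h u).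
Proof.
move=> M0 /argmin_add_dom [hz zmin]; split=> // u hu.
apply: (@le_vanishing _ _ _ (M / 2 * `|u - z| ^+ 2)) => [|t /andP[t0 t1]].
  by rewrite mulr_ge0// ?exprn_ge0// divr_ge0.
have [hw hle] := Conv_fine hu hz (introT andP (conj (ltW t0) t1)).
have hmin := zmin _ hw.
move: hle hmin; have -> : t *: u + (1 - t) *: z = z + t *: (u - z).
  by rewrite scalerBr scalerBl scale1r addrCA.
have -> : z + t *: (u - z) - y = (z - y) + t *: (u - z) by rewrite addrAC.
move: (u - z) => d hle hmin; rewrite -subr_ge0 -(pmulr_rge0 _ t0).
move: hmin; rewrite (sqr_normD ip_norm (z - y)) normrZ exprMn (gtr0_norm t0).
rewrite (ipDr ip z) (ipDl ip a) !ipZr ipZl; lra.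
Qed.

End ConvexFunction.

Section ScaledConvex.
Context {R : realType} {Z : normedModType R}.
Variables (h : Z -> \bar R) (lambda : R).
Hypotheses (ch : Conv h) (l0 : 0 < lambda).

Lemma dom_da_psin : dom (da_psin h lambda) = dom h.
Proof.
rewrite /dom /da_psin; apply/seteqP; have [hN _ _ _] := ch.
split=> x /=; have := hN x; case: (h x) => [r|//|//] _; rewrite ?ltry//.
by rewrite mulry gtr0_sg// mul1e.
Qed.

Lemma fine_da_psin x : dom h x -> fine (da_psin h lambda x) = lambda * fine (h x).
Proof. by move=> hx; rewrite /da_psin (Conv_fineK ch hx) -EFinM. Qed.

End ScaledConvex.

Section Psis.
Context {R : realType} {Z : normedModType R} (ip : {dot Z for idfun}).
Hypothesis ip_norm : forall x, `|x| = Num.sqrt (ip x x).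
Variables (f1 f2 : Z -> R) (lambda : R).
Hypotheses (f2C1 : C1 ip f2).
Hypothesis psisC1 : forall z0, C1 ip (da_psis ip f1 f2 lambda z0).

Lemma grad_da_psis z0 u : grad ip (da_psis ip f1 f2 lambda z0) u =
  lambda *: (grad ip f1 z0 + grad ip f2 u) + (u - z0).
Proof.
apply: (gradP ip_norm (psisC1 z0)) => v.
set G1 := grad ip f1 z0; set G2 := grad ip f2 u.
(* The summand with factor [0] is the limit of [t * (|v|^2 / 2)], the second-order part of the
   square. *)
have -> : ip (lambda *: (G1 + G2) + (u - z0)) v =
    lambda * (ip G1 v) + ip (u - z0) v + lambda * ip G2 v + 0 * (`|v| ^+ 2 / 2).
  by rewrite mul0r addr0 !ipE; ring.
have : (lambda * (ip G1 v) + ip (u - z0) v +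
    lambda * (t^-1 * (f2 (t *: v + u) - f2 u)) + t * (`|v| ^+ 2 / 2)) @[t --> 0^'] -->
    lambda * (ip G1 v) + ip (u - z0) v + lambda * ip G2 v + 0 * (`|v| ^+ 2 / 2).
  apply: cvgD; last by apply: cvgMr_tmp; exact: nbhs_dnbhs.
  apply: cvgD; first exact: cvg_cst.
  by apply: cvgMl_tmp; exact: cvg_grad.
apply: cvg_trans; apply: near_eq_cvg; near=> t.
have t0 : t != 0 by near: t; exact: nbhs_dnbhs_neq.
rewrite /da_psis /lin -/G1.
have -> : t *: v + u - z0 = (u - z0) + t *: v by rewrite -addrA addrC.
rewrite (sqr_normD ip_norm (u - z0)) ipDr !ipZr normrZ exprMn real_normK ?num_real//.
field.
by [].
Unshelve. all: by end_near.
Qed.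

(** The linearization of [f1] cancels. For convex [f2] this yields the strong convexity with modulus
    [mu = 1] that the invariants of R-ACG require. *)
Lemma da_psis_lin z0 u y :
  da_psis ip f1 f2 lambda z0 u - lin ip (da_psis ip f1 f2 lambda z0) u y =
  lambda * (f2 u - lin ip f2 u y) + 1 / 2 * `|u - y| ^+ 2.
Proof.
rewrite /lin grad_da_psis /da_psis /lin.
move: (grad ip f1 z0) (grad ip f2 y) (f1 z0) (f2 u) (f2 y) => G1 G2 c cu cy.
rewrite !(sqr_norm ip_norm) !ipE.
by rewrite !(ipC ip z0 u) !(ipC ip z0 y) !(ipC ip y u); field.
Qed.

End Psis.

Lemma argmin_proj (R : realType) (Z : normedModType R) (ip : {dot Z for idfun})
    (Omega : set Z) (w p : Z) :
  (forall x, `|x| = Num.sqrt (ip x x)) ->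
  (forall x y (t : R), Omega x -> Omega y -> 0 <= t <= 1 ->
     Omega (t *: x + (1 - t) *: y)) ->
  is_argmin Omega (fun u => 1 / 2 * `|u - w| ^+ 2) p ->
  forall u, Omega u -> ip (w - p) (u - p) <= 0.
Proof.
move=> ip_norm convO [Op pmin] u Ou.
apply: (@le_vanishing _ _ _ (1 / 2 * `|u - p| ^+ 2)) => [|t /andP[t0 t1]].
  by rewrite mulr_ge0 ?exprn_ge0// divr_ge0.
have := pmin _ (convO u p t Ou Op (introT andP (conj (ltW t0) t1))).
have -> : t *: u + (1 - t) *: p - w = - (w - p) + t *: (u - p).
  by rewrite scalerBr scalerBl scale1r opprB [X in X - w]addrCA addrAC.
rewrite -(normrN (p - w)) opprB (sqr_normD ip_norm (- (w - p))) normrN.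
rewrite ipNl ipZr normrZ exprMn.
rewrite (gtr0_norm t0) => h1; rewrite -subr_ge0 -(pmulr_rge0 _ t0).
move: h1; rewrite -[(_ <= _)%O]/(_ <= _); lra.
Qed.

(** * The R-ACG method *)

Section RACGRuns.
Context {R : realType} {Z : normedModType R} (ip : {dot Z for idfun}).
Hypothesis ip_norm : forall x, `|x| = Num.sqrt (ip x x).
Variables (mu M : R) (psis : Z -> R) (psin : Z -> \bar R) (z0 : Z) (theta : R).
Hypothesis input : racg_input ip mu M psis psin.

Local Notation step := (racg_step ip mu M psis psin).
Local Notation zt := (racg_zt mu M).
Local Notation b := (racg_b mu M).

Let mu0 : 0 < mu. Proof. by case: input => /andP[]. Qed.
Let muM : mu < M. Proof. by case: input => /andP[]. Qed.
Let M0 : 0 <= M. Proof. exact: ltW (lt_trans mu0 muM). Qed.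
Let cpsin : Conv psin. Proof. by case: input. Qed.

Lemma step_objE x :
  (fun u => ((lin ip psis u x)%:E + psin u + (M / 2 * `|u - x| ^+ 2)%:E)%E) =
  (fun u => ((psis x - ip (grad ip psis x) x + ip (grad ip psis x) u
              + M / 2 * `|u - x| ^+ 2)%:E + psin u)%E).
Proof.
apply/funext => u; rewrite addeAC -EFinD /lin ipDr ipNr.
by congr (_%:E + _)%E; ring.
Qed.

Lemma RP_objE y v :
  (fun u => ((ip (grad ip psis y - v) u + M / 2 * `|u - y| ^+ 2)%:E + psin u)%E) =
  (fun u => ((0 + ip (grad ip psis y - v) u + M / 2 * `|u - y| ^+ 2)%:E + psin u)%E).
Proof. by apply/funext => u; rewrite add0r. Qed.

Lemma continuous_quad (k : R) (a y : Z) :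
  continuous (fun u => k + ip a u + M / 2 * `|u - y| ^+ 2 : R).
Proof.
move=> u; apply: (@cvgD R R^o _ (nbhs u) _ (fun u => k + ip a u)).
  apply: (@cvgD R R^o _ (nbhs u) _ (fun=> k)); first exact: cvg_cst.
  exact: continuous_ip.
apply: (@cvgMl_tmp R _ (nbhs u) _ (fun u : Z => `|u - y| ^+ 2)).
apply: (@cvg_comp _ _ _ (fun u => `|u - y|) (fun t : R => t ^+ 2));
  last exact: exprn_continuous.
by apply: cvg_norm; apply: (@cvgB R Z _ (nbhs u) _ id); [exact: cvg_id|exact: cvg_cst].
Qed.

Lemma racg_step_exists s : compact (dom psin) -> exists s', step s s'.
Proof.
move=> ck; have [z zP] := argmin_add_exists cpsin ck
  (@continuous_quad (psis (zt s) - ip (grad ip psis (zt s)) (zt s))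
     (grad ip psis (zt s)) (zt s)).
by exists (racg_next ip mu M psis psin s z), z; rewrite step_objE.
Qed.

Lemma racg_stepP s s' : step s s' ->
  exists z, [/\ s' = racg_next ip mu M psis psin s z, dom psin z &
    forall u, dom psin u -> fine (psin z)
      - ip (grad ip psis (zt s) + M *: (z - zt s)) (u - z) <= fine (psin u)].
Proof.
move=> [z []]; rewrite step_objE.
by move=> /(argmin_quad_subgradient cpsin ip_norm M0) [? ?] ?; exists z.
Qed.

Lemma RP_exists y v : compact (dom psin) ->
  exists yr vr, RP ip M psis psin y v yr vr.
Proof.
move=> ck; have [yr yrP] := argmin_add_exists cpsin ck
  (@continuous_quad 0 (grad ip psis y - v) y).
by exists yr, (v + M *: (y - yr) + grad ip psis yr - grad ip psis y); split;
  rewrite // RP_objE.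
Qed.

(** The optimality condition of the refinement problem; the correction terms in [vr] are chosen so
    that it takes this form. It is the source of the inclusion in (b). *)
Lemma RP_subgradient y v yr vr : RP ip M psis psin y v yr vr ->
  dom psin yr /\ forall u, dom psin u ->
    fine (psin yr) + ip (vr - grad ip psis yr) (u - yr) <= fine (psin u).
Proof.
rewrite /RP RP_objE => -[/(argmin_quad_subgradient cpsin ip_norm M0) [? H] ->].
split=> // u /H; move: (grad _ _ y) (grad _ _ yr) => G G'; rewrite !ipE; lra.
Qed.

(** Adding the two subgradient inequalities leaves [M |yr - yr'|^2 <= 0]. It matters because R-ACG
    tests one refinement and the outer method computes it again. *)
Lemma RP_unique y v yr vr yr' vr' : RP ip M psis psin y v yr vr ->
  RP ip M psis psin y v yr' vr' -> yr = yr'.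
Proof.
move=> H H'; have [d s] := RP_subgradient H; have [d' s'] := RP_subgradient H'.
have M1 := lt_trans mu0 muM.
apply/eqP; rewrite -subr_eq0 -normr_eq0 -sqrf_eq0 eq_le exprn_ge0// andbT.
rewrite -(pmulr_rle0 _ M1).
have := s _ d'; have := s' _ d; move: H H' => [_ ->] [_ ->].
move: (grad _ _ y) (grad _ _ yr) (grad _ _ yr') => G G1 G2.
by rewrite (sqr_norm ip_norm) !ipE !(ipC ip yr' yr); lra.
Qed.

(* Add the [M]-strong convexity of the [RP] objective at its minimizer [yr] to the
   upper curvature bound on [psis]. *)
Lemma RP_dist y v yr vr eps : dom psin y -> RP ip M psis psin y v yr vr ->
  Delta ip mu psis psin yr y v <= eps -> (M + mu) / 2 * `|yr - y| ^+ 2 <= eps.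
Proof.
move=> dy H D; have [dyr s] := RP_subgradient H.
have [_ _ _ /(_ yr y)] := input; have [_ vrE] := H.
move: D (s y dy); rewrite vrE.
rewrite /lin /Delta /psi !(sqr_norm ip_norm) !ipE !(ipC ip yr y).
by lra.
Qed.

(** [b] is the positive root of [b^2 = xi (B + b)], and [b >= xi >= 1 / (M - mu)]; the last bound
    makes [B] grow at least linearly. *)
Lemma racg_bP (s : @racg_state R Z) : 0 <= rB s ->
  [/\ 1 / (M - mu) <= b s, 0 < b s &
      (M - mu) * b s ^+ 2 = (1 + mu * rB s) * (rB s + b s)].
Proof.
move=> B0; have d0 : 0 < M - mu by rewrite subr_gt0.
have muB : 0 <= mu * rB s by rewrite mulr_ge0// ltW.
set xi := (1 + mu * rB s) / (M - mu).
have xi0 : 0 < xi by rewrite divr_gt0//; lra.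
have xixi : 1 / (M - mu) <= xi by rewrite ler_pM2r ?invr_gt0//; lra.
have disc0 : 0 <= xi ^+ 2 + 4 * xi * rB s.
  apply: addr_ge0; first exact/exprn_ge0/ltW.
  by apply: mulr_ge0 => //; apply: mulr_ge0 => //; exact: ltW.
set q := Num.sqrt (xi ^+ 2 + 4 * xi * rB s).
have qq : q ^+ 2 = xi ^+ 2 + 4 * xi * rB s by rewrite sqr_sqrtr.
have xiq : xi <= q.
  rewrite -(ler_pXn2r (n := 2)) ?nnegrE ?sqrtr_ge0 ?(ltW xi0)// qq lerDl.
  by apply: mulr_ge0 => //; apply: mulr_ge0 => //; exact: ltW.
have bE : b s = (xi + q) / 2 by [].
have bb : b s ^+ 2 = xi * (rB s + b s).
  by rewrite bE exprMn sqrrD qq; field.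
split; [rewrite bE; lra|rewrite bE; lra|].
by rewrite bb mulrA; congr (_ * _); rewrite /xi mulrC divfK ?gt_eqF.
Qed.

Lemma racg_step_B s s' : 0 <= rB s -> step s s' ->
  rB s + 1 / (M - mu) <= rB s'.
Proof.
by move=> /racg_bP [h _ _] [z [_ ->]]; rewrite /= lerD2l.
Qed.

Hypothesis theta01 : 0 < theta < 1.

(** With [w = z - z0], step 3 bounds [|B r + w|^2] by [(1 + mu B) |w|^2] and [2 B eta] by [|w|^2].
    Hence [B^2 (|r|^2 + 2 eta)] is at most [(4 + 2 mu B + B) |w|^2], and [B >= 1] turns the factor
    into [(2 mu + 5) B]. *)
Lemma racg_check34 s : (2 * mu + 5) / theta ^+ 2 <= rB s ->
  racg_check3 ip mu psis psin z0 s -> racg_check4 ip mu psis psin z0 theta s.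
Proof.
have /andP[t0 t1] := theta01; rewrite /racg_check3 /racg_check4.
have eta0 : 0 <= racg_eta ip mu psis psin z0 s by rewrite le_max lexx.
rewrite -!addrA; move: (rB s) (racg_r _ _ _) (racg_eta _ _ _ _ _ _) (rz s - z0) eta0.
move=> B r eta w eta0 BB; have mu_gt0 := mu0.
have t2 : 0 < theta ^+ 2 by rewrite exprn_gt0.
have Bt : 2 * mu + 5 <= theta ^+ 2 * B by rewrite [_ * B]mulrC -ler_pdivrMr.
have B1 : 1 <= B.
  have t2' : theta ^+ 2 <= 1 by rewrite exprn_ile1 ?(ltW t0) ?(ltW t1).
  rewrite leNgt; apply/negP => B1.
  have B0 : 0 <= B by apply: le_trans BB; rewrite divr_ge0 ?(ltW t2)//; lra.
  have := ler_wpM2r B0 t2'; lra.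
have muB' : 0 <= mu * B by apply: mulr_ge0; [exact: ltW|lra].
have muB : 0 < 1 + mu * B by lra.
move=> c3; have := ler_wpM2l (ltW muB) c3.
rewrite mulrDr mulrA divff ?gt_eqF// mul1r => c3'.
have W : `|B *: r + w| ^+ 2 <= (1 + mu * B) * `|w| ^+ 2.
  by apply: le_trans c3'; rewrite lerDl; apply: mulr_ge0 => //; [lra|
    apply: mulr_ge0 => //; apply: mulr_ge0 => //; lra].
have E : 2 * B * eta <= `|w| ^+ 2.
  by apply: le_trans c3; rewrite lerDr mulr_ge0 ?exprn_ge0// invr_ge0 ltW.
have BBr : B ^+ 2 * `|r| ^+ 2 <= 2 * `|B *: r + w| ^+ 2 + 2 * `|w| ^+ 2.
  rewrite -subr_ge0.
  have -> : 2 * `|B *: r + w| ^+ 2 + 2 * `|w| ^+ 2 - B ^+ 2 * `|r| ^+ 2 =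
    `|B *: r + 2 *: w| ^+ 2 by rewrite !(sqr_norm ip_norm) !ipE (ipC ip w r); ring.
  exact: exprn_ge0.
have B0 : 0 < B ^+ 2 by rewrite exprn_gt0//; lra.
rewrite -(ler_pM2l B0).
have h1 := ler_wpM2l (_ : 0 <= B) E; have h2 := ler_wpM2r (exprn_ge0 2 (normr_ge0 w)) Bt.
have h3 : B * ((2 * mu + 5) * `|w| ^+ 2) <= B * (theta ^+ 2 * B * `|w| ^+ 2).
  by apply: ler_wpM2l h2; lra.
have h4 : `|w| ^+ 2 <= B * `|w| ^+ 2 by rewrite ler_peMl ?exprn_ge0.
have {}h1 := h1 (le_trans ler01 B1).
by rewrite mulrDr; lra.
Qed.

Lemma racg_iter_exists s : compact (dom psin) ->
  exists o, racg_iter ip mu M psis psin z0 theta s o.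
Proof.
move=> ck; have [s' ss'] := racg_step_exists s ck.
have [c3|c3] := pselect (racg_check3 ip mu psis psin z0 s'); last first.
  by exists Failure; exact: racg_fail3 ss' c3.
have [c4|c4] := pselect (racg_check4 ip mu psis psin z0 theta s'); last first.
  by exists (Continue s'); exact: racg_continue ss' c3 c4.
have [yr [vr rp]] := RP_exists (rz s') (racg_r mu z0 s') ck.
have [D|D] := pselect (Delta ip mu psis psin yr (rz s') (racg_r mu z0 s')
                      <= racg_eta ip mu psis psin z0 s').
- by eexists; exact: racg_success ss' c3 c4 rp D.
- by exists Failure; exact: racg_fail5 ss' c3 c4 rp D.
Qed.

Lemma racg_terminates : compact (dom psin) ->
  exists o, racg ip mu M psis psin z0 theta o.
Proof.
move=> ck; have d0 : 0 < M - mu by rewrite subr_gt0.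
pose c := 1 / (M - mu).
have c0 : 0 < c by rewrite divr_gt0.
pose Bb := (2 * mu + 5) / theta ^+ 2.
(* [n] counts the increments [c] by which [B] may still fall short of [Bb]. With none left, a
   continuing iteration would pass step 3 but not step 4, against [racg_check34]. *)
suff H (n : nat) s : 0 <= rB s -> Bb <= rB s + n%:R * c ->
    exists o, returns (racg_iter ip mu M psis psin z0 theta) s o.
  pose n := Num.truncn (Bb / c).
  by apply: (H n.+1) => //=; rewrite add0r -ler_pdivrMr//; exact: ltW (truncnS_gt _).
elim: n s => [|n IH] s B0 Bs; have [out it] := racg_iter_exists s ck.
all: case: out it => [s1| |t] it; first last.
1,4: by exists (Some t); exact: returns_success.
1,3: by exists None; exact: returns_failure.
all: have [ss' c3 c4] : [/\ step s s1, racg_check3 ip mu psis psin z0 s1 &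
    ~ racg_check4 ip mu psis psin z0 theta s1]
  by inversion it.
all: have B' : rB s + c <= rB s1 by exact: racg_step_B.
- by exfalso; apply: c4; apply: racg_check34 => //; rewrite -/Bb; lra.
- have [| |o oP] := IH s1; [lra|by move: Bs; rewrite -natr1 mulrDl; lra|].
  by exists o; exact: returns_continue it oP.
Qed.

Lemma racg_output y v eps : racg ip mu M psis psin z0 theta (Some (y, v, eps)) ->
  [/\ dom psin y, 0 <= eps, `|v| ^+ 2 + 2 * eps <= theta ^+ 2 * `|y - z0| ^+ 2 &
    forall yr vr, RP ip M psis psin y v yr vr ->
      (M + mu) / 2 * `|yr - y| ^+ 2 <= eps].
Proof.
rewrite /racg; move: (racg_init z0) => s; move oE : (Some _) => o run.
elim: run oE => [//|{}s t it tE|s1 s2 o' _ _ IH /IH //].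
case: tE it => <- it; move tE : (Success _) it => o' it.
case: it tE => // s' yr vr ss' c3 c4 rp D [-> -> ->].
have [z [s'E dz _]] := racg_stepP ss'.
have dz' : dom psin (rz s') by rewrite s'E.
split=> //; first by rewrite le_max lexx.
move=> yr' vr' rp'; rewrite -(RP_unique rp rp').
exact: RP_dist dz' rp D.
Qed.

End RACGRuns.

(** Multiplied by [B], the form is the square [k / 2 |B g + b e|^2]. The relation on [c] is the
    equation for the step [b] in [racg_bP], with [B + b] in the role of [B]. *)
Lemma quad_form_ge0 (R : realType) (Z : normedModType R) (ip : {dot Z for idfun})
    (b B k c : R) (g e : Z) : (forall x, `|x| = Num.sqrt (ip x x)) ->
  0 < B -> 0 <= k -> c * B = k * b ^+ 2 ->
  0 <= k * (B / 2 * `|g| ^+ 2 + b * ip g e) + c / 2 * `|e| ^+ 2.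
Proof.
move=> ip_norm B0 k0 cB; rewrite -(pmulr_rge0 _ B0).
have -> : B * (k * (B / 2 * `|g| ^+ 2 + b * ip g e) + c / 2 * `|e| ^+ 2) =
    k / 2 * `|B *: g + b *: e| ^+ 2.
  have -> : B * (k * (B / 2 * `|g| ^+ 2 + b * ip g e) + c / 2 * `|e| ^+ 2) =
     B * (k * (B / 2 * `|g| ^+ 2 + b * ip g e)) + (c * B) / 2 * `|e| ^+ 2 by ring.
  by rewrite cB !(sqr_norm ip_norm) !ipE (ipC ip e g); field.
by rewrite mulr_ge0// ?exprn_ge0// divr_ge0.
Qed.

(** * R-ACG on strongly convex problems: it never fails *)

Section RACGConvex.
Context {R : realType} {Z : normedModType R} (ip : {dot Z for idfun}).
Hypothesis ip_norm : forall x, `|x| = Num.sqrt (ip x x).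
Variables (mu M : R) (psis : Z -> R) (psin : Z -> \bar R) (z0 : Z) (theta : R).
Hypothesis input : racg_input ip mu M psis psin.
Hypothesis strong_convexity :
  forall u y, mu / 2 * `|u - y| ^+ 2 <= psis u - lin ip psis u y.

Local Notation step := (racg_step ip mu M psis psin).
Local Notation zt := (racg_zt mu M).
Local Notation b := (racg_b mu M).
Local Notation gamma := (racg_gamma ip mu M psis psin).

Let mu0 : 0 < mu. Proof. by case: input => /andP[]. Qed.
Let muM : mu < M. Proof. by case: input => /andP[]. Qed.

(* [m] is the minimum of [B Gamma + |. - z0|^2 / 2], attained at [zc]. *)
Definition racg_inv (s : racg_state) : Prop :=
  [/\ 0 <= rB s,
      0 < rB s -> dom psin (rz s),
      forall u, dom psin u -> rB s * rGamma s u <= rB s * psi psis psin u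
    & exists m, (forall u, rB s * rGamma s u + `|u - z0| ^+ 2 / 2
                  = m + (1 + mu * rB s) / 2 * `|u - rzc s| ^+ 2) /\
                rB s * psi psis psin (rz s) <= m].

Lemma racg_inv_init : racg_inv (racg_init z0).
Proof.
split=> //= [|u _|]; rewrite ?ltxx ?mul0r//; exists 0.
by split=> [u|]; rewrite ?mul0r// mulr0 addr0 !add0r mulrC mul1r.
Qed.

(** Strong convexity puts [racg_gammat] below [psi]. It is itself [mu]-strongly convex, with
    subgradient [(M - mu) (zt - z)] at [z] by optimality of [z], and [gamma] is the resulting
    quadratic minorant. *)
Lemma racg_gamma_le s z : dom psin z ->
  (forall u, dom psin u -> fine (psin z)
      - ip (grad ip psis (zt s) + M *: (z - zt s)) (u - z) <= fine (psin u)) ->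
  forall u, dom psin u -> gamma s z u <= psi psis psin u.
Proof.
move=> dz zP u du; have := zP u du; have := strong_convexity u (zt s).
rewrite /racg_gamma /racg_gammat /psi /lin; move: (zt s) (grad _ _ _) => x G.
rewrite !(sqr_norm ip_norm) !ipE !(ipC ip z u) !(ipC ip x u) !(ipC ip x z).
by lra.
Qed.

Lemma racg_inv_step s s' : racg_inv s -> step s s' -> racg_inv s' /\ 0 < rB s'.
Proof.
move=> [B0 dz0 Gle [m [Geq mge]]] /(racg_stepP ip_norm input) [z [-> dz zP]].
have [_ b0 bb] := racg_bP input B0.
have gle := racg_gamma_le dz zP.
have [_ _ _ /(_ z (zt s)) up] := input.
set B := rB s in B0 dz0 Gle Geq mge bb *.
have B'0 : 0 < B + b s by rewrite ltr_wpDl.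
have muB : 0 <= mu * B by rewrite mulr_ge0 ?(ltW mu0).
have muB' : 0 < 1 + mu * (B + b s).
  by have := mulr_gt0 mu0 b0; rewrite mulrDr; lra.
have G'E u : (B + b s) * rGamma (racg_next ip mu M psis psin s z) u =
    B * rGamma s u + b s * gamma s z u.
  by rewrite /= -/B; field; rewrite gt_eqF.
have ztE : (B + b s) *: zt s = B *: rz s + b s *: rzc s.
  by rewrite /racg_zt scalerDr !scalerA -/B !(mulrC (B + b s)) !divfK ?gt_eqF.
set zc' := rzc (racg_next ip mu M psis psin s z).
have zcE : (1 + mu * (B + b s)) *: zc' = rzc s - (b s * (M - mu)) *: (zt s - z)
        + mu *: (B *: rzc s + b s *: z).
  by rewrite /zc' /= scalerA mulfV ?gt_eqF// scale1r.
have zcD : rzc (racg_next ip mu M psis psin s z) = zc' by [].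
clearbody zc'.
have Mmu : 0 < M - mu by rewrite subr_gt0.
split; last by rewrite /= -/B.
split=> [|//|u du|]; rewrite -?/zc'.
- by rewrite /= -/B ltW.
- rewrite G'E /= -/B mulrDl lerD// ?Gle// ler_wpM2l ?(ltW b0)//; exact: gle.
(* The old estimate function, expanded about its minimizer, plus the new piece, both taken at [zc'];
   [zcE] says that [zc'] is a stationary point of the sum. *)
exists (m + (1 + mu * B) / 2 * `|zc' - rzc s| ^+ 2 + b s * gamma s z zc').
rewrite zcD; split=> [u|].
  rewrite G'E /= -/B addrAC Geq -(subrK zc' u); move: (u - zc') => d.
  have := congr1 (ip d) zcE; rewrite /racg_gamma !(sqr_norm ip_norm).
  move: (zt s) (rzc s) (racg_gammat _ _ _ _ _ _ _) => x zc c0.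
  rewrite !ipE !(ipC ip _ d); lra.
rewrite /= -/B.
(* [psi] dominates [gamma] at [rz s], so the old bound [mge] carries over. The case [B = 0] is apart
   because the starting point may lie outside the domain of [psin]. *)
have Bg : B * gamma s z (rz s) <= m.
  apply: le_trans mge; case: (ltgtP B 0) B0 => // [B_gt0 _|-> _].
    by apply: ler_wpM2l; [exact: ltW|apply: gle; exact: dz0].
  by rewrite !mul0r.
have zle : psi psis psin z <=
    racg_gammat ip mu M psis psin s z + (M - mu) / 2 * `|zt s - z| ^+ 2.
  by rewrite /racg_gammat /psi (distrC (zt s)); lra.
have := quad_form_ge0 (zt s - z) (zc' - rzc s) ip_norm B'0 (ltW Mmu) (esym bb).
have := ler_wpM2l (ltW B'0) zle.
have := congr1 (fun v => (M - mu) * ip (zt s - z) v) ztE.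
have := mulr_ge0 (mulr_ge0 B0 (ltW mu0)) (exprn_ge0 2 (normr_ge0 (rz s - z))).
have := mulr_ge0 (mulr_ge0 (ltW b0) (ltW mu0)) (exprn_ge0 2 (normr_ge0 (zc' - z))).
move: Bg; rewrite /racg_gamma.
move: (psi psis psin z) (racg_gammat _ _ _ _ _ _ _) (zt s) (rz s) (rzc s).
move=> p c0 x o c; rewrite !(sqr_norm ip_norm) !ipE.
rewrite ?(ipC ip z x) ?(ipC ip o x) ?(ipC ip c x) ?(ipC ip zc' x) ?(ipC ip o z).
rewrite ?(ipC ip c z) ?(ipC ip zc' z) ?(ipC ip c o) ?(ipC ip zc' o) ?(ipC ip zc' c).
lra.
Qed.

(** [Gamma] is a quadratic with Hessian [mu], and [r] is its gradient at [z]. As [Gamma <= psi], the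
    maximum in [eta] is inactive and [eta = psi z - Gamma z]. The test of step 3 then reduces to
    [B psi z <= m], and [Delta - eta] to [Gamma u - psi u]. *)
Lemma racg_inv_sharp s : racg_inv s -> 0 < rB s ->
  [/\ racg_check3 ip mu psis psin z0 s &
      forall u, dom psin u ->
      Delta ip mu psis psin u (rz s) (racg_r mu z0 s) <= racg_eta ip mu psis psin z0 s].
Proof.
move=> [_ dz Gle [m [Geq mge]]] B0; have {}dz := dz B0.
have GE u : rGamma s u = rGamma s (rzc s) + (rB s)^-1 * ip (z0 - rzc s) (u - rzc s)
    + mu / 2 * `|u - rzc s| ^+ 2.
  have := Geq u; have := Geq (rzc s).
  rewrite subrr normr0 expr0n mulr0 addr0 => <- E.
  apply: (mulfI (lt0r_neq0 B0)); rewrite !mulrDr mulVKf ?gt_eqF//.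
  move: E; rewrite !(sqr_norm ip_norm) !ipE !(ipC ip z0) !(ipC ip u (rzc s)); lra.
have rE v : ip (racg_r mu z0 s) v =
    (rB s)^-1 * ip (z0 - rzc s) v + mu * ip (rz s - rzc s) v.
  by rewrite /racg_r ipDl !ipZl.
have etaE : racg_eta ip mu psis psin z0 s = psi psis psin (rz s) - rGamma s (rz s).
  have ge0 : rGamma s (rz s) <= psi psis psin (rz s).
    by rewrite -(ler_pM2l B0) Gle.
  rewrite /racg_eta rE -(sqr_norm ip_norm).
  have -> : psi psis psin (rz s) - rGamma s (rzc s) -
     ((rB s)^-1 * ip (z0 - rzc s) (rz s - rzc s) + mu * `|rz s - rzc s| ^+ 2) +
     mu / 2 * `|rz s - rzc s| ^+ 2 = psi psis psin (rz s) - rGamma s (rz s).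
    by rewrite (GE (rz s)); lra.
  by rewrite max_r// subr_ge0.
split.
  rewrite /racg_check3 etaE.
  have -> : rB s *: racg_r mu z0 s + rz s - z0 = (1 + mu * rB s) *: (rz s - rzc s).
    have -> : rB s *: racg_r mu z0 s = z0 - rzc s + (mu * rB s) *: (rz s - rzc s).
      by rewrite /racg_r [LHS]scalerDr !scalerA mulfV ?gt_eqF// scale1r (mulrC mu).
    rewrite scalerDl scale1r [LHS]addrC !addrA addNr add0r.
    by rewrite [LHS]addrC addrA.
  have muB : 0 < 1 + mu * rB s by rewrite ltr_wpDr// mulr_ge0// ltW.
  rewrite normrZ exprMn (gtr0_norm muB) expr2 !mulrA mulVf ?gt_eqF// mul1r.
  by have := Geq (rz s); lra.
move=> u du; rewrite etaE /Delta rE.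
have : rGamma s u <= psi psis psin u by rewrite -(ler_pM2l B0) Gle.
rewrite (GE u) (GE (rz s)) !(sqr_norm ip_norm) !ipE; move: (rB s)^-1 => k.
rewrite !(ipC ip z0) !(ipC ip u (rzc s)) !(ipC ip u (rz s)) !(ipC ip (rz s) (rzc s)).
lra.
Qed.

Lemma racg_convex o : racg ip mu M psis psin z0 theta o ->
  exists y v eps, o = Some (y, v, eps) /\
    forall u, dom psin u -> Delta ip mu psis psin u y v <= eps.
Proof.
rewrite /racg; move: (racg_init z0) racg_inv_init => s + run.
elim: run => {s o} [s it|s t it|s s' o it _ IH] inv.
- move: it; move oE : Failure => o' it; case: it oE => //.
    by move=> s' /(racg_inv_step inv)[inv' /(racg_inv_sharp inv')[? _]].
  move=> s' yr vr /(racg_inv_step inv)[inv' /(racg_inv_sharp inv')[_ D]] _ _ rp.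
  by case; apply: D; have [] := RP_subgradient ip_norm input rp.
- move: it; move oE : (Success t) => o' it; case: it oE => // s' yr vr.
  move=> /(racg_inv_step inv)[inv' /(racg_inv_sharp inv')[_ D]] _ _ _ _ [->].
  by exists (rz s'), (racg_r mu z0 s'), (racg_eta ip mu psis psin z0 s').
- apply: IH; move: it; move oE : (Continue s') => o' it; case: it oE => //.
  by move=> s1 /(racg_inv_step inv)[inv' _] _ _ [->].
Qed.

End RACGConvex.

(** * Counting iterations *)

Section RunLength.
Variables (S T : Type) (iter : S -> outcome S T -> Prop) (P : S -> Prop).
Hypothesis iter_exists : forall s, P s -> exists o, iter s o.
Hypothesis iter_inv : forall s s', P s -> iter s (Continue s') -> P s'.

Definition chain (n : nat) (s : S) (x : nat -> S) :=
  x 0%N = s /\ forall i, (i < n)%N -> iter (x i) (Continue (x i.+1)).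

Lemma chain_cons n s s' x : iter s (Continue s') -> chain n s' x ->
  chain n.+1 s (fun i => if i is j.+1 then x j else s).
Proof. by move=> ss' [x0 xS]; split=> // -[|i] /= => [_|/xS//]; rewrite x0. Qed.

(** Iterations may branch, so iteration bounds go through single chains: a run still going after [n]
    iterations contains one, and the real estimates need only its sequence of states. *)
Lemma stops_withinP n s : P s -> (forall x, ~ chain n s x) -> stops_within iter n s.
Proof.
elim: n s => [|n IH] s Ps nc; first by apply: (nc (fun=> s)); split.
split; first exact: iter_exists.
move=> s' ss'; apply: IH; first exact: iter_inv ss'.
by move=> x /(chain_cons ss'); exact: nc.
Qed.

Hypothesis no_failure : forall s, P s -> ~ iter s Failure.

Lemma succeeds_withinP n s : P s -> (forall x, ~ chain n s x) ->
  succeeds_within iter n s.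
Proof.
elim: n s => [|n IH] s Ps nc; first by apply: (nc (fun=> s)); split.
split; [exact: iter_exists|exact: no_failure|].
move=> s' ss'; apply: IH; first exact: iter_inv ss'.
by move=> x /(chain_cons ss'); exact: nc.
Qed.

End RunLength.

Section Counting.
Context {R : realType}.
Implicit Types (A p F : nat -> R) (q : R).

(* Only the second half of the iterations is summed: there [A i >= n^2 / 4], so
   that the errors [W / A i] add up to [O(W / n)]. *)
Lemma window_sum A p q W n : (0 < n)%N -> 0 <= W ->
  (forall i, (i <= n + n)%N -> i%:R ^+ 2 <= 4 * A i) ->
  (forall i, (i < n + n)%N -> A i.+1 * q <= A i.+1 * (p i - p i.+1) + W) ->
  n%:R ^+ 2 * q <= n%:R * (p n - p (n + n)%N) + 4 * W.
Proof.
move=> n0 W0 Age Astep; have n0' : 0 < n%:R :> R by rewrite ltr0n.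
have H j : (j <= n)%N -> n%:R ^+ 2 * (j%:R * q) <=
    n%:R ^+ 2 * (p n - p (n + j)%N) + j%:R * (4 * W).
  elim: j => [_|j IH jn]; first by rewrite addn0 subrr !mul0r !mulr0 addr0.
  have {}IH := IH (ltnW jn).
  have := Astep (n + j)%N; rewrite ltn_add2l => /(_ jn) st.
  have := Age (n + j).+1; rewrite -addnS leq_add2l => /(_ jn) Ai.
  rewrite -addnS in st.
  have nA : n%:R ^+ 2 <= 4 * A (n + j.+1)%N.
    by apply: le_trans Ai; rewrite ler_pXn2r ?nnegrE ?ler0n// ler_nat leq_addr.
  have A0 : 0 < A (n + j.+1)%N by have := exprn_gt0 2 n0'; lra.
  (* Division by [A] is avoided: if [q] exceeds the drop of [p], the factor [A] of the excess may be
     lowered to [n^2 / 4]. *)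
  have key : n%:R ^+ 2 * q <= n%:R ^+ 2 * (p (n + j)%N - p (n + j.+1)%N) + 4 * W.
    have [le|gt] := leP q (p (n + j)%N - p (n + j.+1)%N).
      have := ler_wpM2l (ltW (exprn_gt0 2 n0')) le; lra.
    have d0 : 0 <= q - (p (n + j)%N - p (n + j.+1)%N) by rewrite subr_ge0 ltW.
    have := ler_wpM2r d0 nA; lra.
  by rewrite -natr1; move: IH key; rewrite !mulrDl !mulrDr; lra.
have {}H := H n (leqnn n).
rewrite -(ler_pM2l n0'); move: H; rewrite expr2; lra.
Qed.

(** Telescoping. The gains [A i * q >= q i^2 / 4] add up to [q n^3 / 12] because [3 (n + 1)^2 - ((n
    + 1)^3 - n^3) = 3 n + 2] is nonnegative. *)
Lemma potential_sum A F q k D D' n : 0 <= q -> A 0%N = 0 ->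
  (forall i, (i <= n)%N -> i%:R ^+ 2 <= 4 * A i) ->
  (forall i, (i < n)%N -> F i.+1 + A i.+1 * q <=
     F i + k * (2 * D + (A i.+1 - A i) * D')) ->
  q * n%:R ^+ 3 / 12 + F n <= F 0%N + k * (2 * n%:R * D + A n * D').
Proof.
move=> q0 A0; elim: n => [_ _|n IH Age st].
  by rewrite A0 expr0n /= !mulr0 !mul0r add0r; lra.
have {}IH := IH (fun i h => Age i (leqW h)) (fun i h => st i (leqW h)).
have := ler_wpM2l q0 (Age n.+1 (leqnn _)); have := st n (leqnn _).
have : 0 <= q * (3 * n%:R + 2) by rewrite mulr_ge0// addr_ge0// mulr_ge0.
by rewrite -(natr1 n); lra.
Qed.

Lemma nat_gt (x : R) : 0 <= x -> exists n : nat, [/\ (0 < n)%N, x < n%:R & n%:R <= x + 1].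
Proof.
move=> x0; exists (Num.truncn x).+1; split=> //; first exact: truncnS_gt.
by rewrite -natr1 lerD2r truncn_le.
Qed.

(* The numbers [T1], [T2], [T3] are those of part (c) of the theorem. *)
Lemma cubic_bound (n T1 T2 T3 : R) : 0 <= T1 -> 0 <= T2 -> 0 <= T3 ->
  n ^+ 3 <= 96 * T3 ^+ 3 + 192 * (n * T2 ^+ 2 + n ^+ 2 * T1 / 2) ->
  n <= 200 * (T1 + T2 + T3).
Proof.
move=> h1 h2 h3 H; rewrite leNgt; apply/negP => nX.
have n0 : 0 < n by lra.
(* With all three numbers below [n / 200], the right side of [H] is at most [(96 / 200^3 + 192 /
   200^2 + 96 / 200) n^3], which is less than [n^3]. *)
have t1 : T1 <= n / 200 by lra.
have t2 : T2 ^+ 2 <= (n / 200) ^+ 2 by rewrite ler_pXn2r ?nnegrE//; lra.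
have t3 : T3 ^+ 3 <= (n / 200) ^+ 3 by rewrite ler_pXn2r ?nnegrE//; lra.
have n2 : 0 <= n ^+ 2 by rewrite exprn_ge0 ?ltW.
have := ler_wpM2l (ltW n0) t2; have := ler_wpM2l n2 t1.
have : 0 < n ^+ 3 by rewrite exprn_gt0.
move: H t3; rewrite !exprMn; lra.
Qed.

End Counting.

(** * The static DA-ICG method *)

(* The estimate-sequence step of accelerated gradient methods, with the affine
   model [c + <v + zt - y, . - y>]. *)
Lemma accel_step (R : realType) (Z : normedModType R) (ip : {dot Z for idfun})
    (A a c P : R) (y zt v x yk x' u : Z) : (forall x, `|x| = Num.sqrt (ip x x)) ->
  0 <= A -> 1 <= a -> a ^+ 2 = A + a -> (A + a) *: zt = A *: yk + a *: x ->
  P + 1 / 4 * `|y - zt| ^+ 2 <= c + 1 / 2 * `|y - zt| ^+ 2 - 1 / 2 * `|v| ^+ 2 ->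
  ip (x - a *: (v + zt - y) - x') (u - x') <= 0 ->
  (A + a) * (P + 1 / 4 * `|y - zt| ^+ 2) + 1 / 2 * `|u - x'| ^+ 2 <=
  A * (c + ip (v + zt - y) (yk - y)) + a * (c + ip (v + zt - y) (u - y))
    + 1 / 2 * `|u - x| ^+ 2.
Proof.
move=> ip_norm A0 a1 aa ztE hP proj; have B0 : 0 < A + a by lra.
(* [w] is to [x'] what [zt] is to [x]. As [w - zt] is [a / (A + a)] times [x' - x], the choice
   [a^2 = A + a] makes the two prox terms match in [wz]. *)
have [w wE] : exists w, (A + a) *: w = A *: yk + a *: x'.
  exists ((A + a)^-1 *: (A *: yk + a *: x')).
  by rewrite scalerA mulfV ?scale1r// gt_eqF.
have wz : (A + a) * `|w - zt| ^+ 2 = `|x' - x| ^+ 2.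
  have e : (A + a) *: (w - zt) = a *: (x' - x).
    by rewrite scalerBr ztE wE scalerBr opprD addrACA subrr add0r.
  have := congr1 (fun t => `|t| ^+ 2) e; rewrite /= !sqr_normZ aa => ee.
  by apply: (mulfI (lt0r_neq0 B0)); rewrite mulrA -expr2.
have gw := congr1 (ip (v + zt - y)) wE.
(* Completing the square, the right side is [c + |y - zt|^2 / 2 - |v|^2 / 2 + |v + w - y|^2 / 2]. *)
have hw : P + 1 / 4 * `|y - zt| ^+ 2 <=
    c + ip (v + zt - y) (w - y) + 1 / 2 * `|w - zt| ^+ 2.
  have := exprn_ge0 2 (normr_ge0 (v + (w - y))); move: hP.
  rewrite !(sqr_norm ip_norm) !ipE.
  rewrite !(ipC ip zt y) !(ipC ip w v) !(ipC ip y v) !(ipC ip w y) !(ipC ip w zt).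
  lra.
have := ler_wpM2l (ltW B0) hw; move: (P + _) hP => Q _ {hw}.
move: proj gw wz; move: (v + zt - y) => g.
rewrite !(sqr_norm ip_norm) !ipE.
rewrite !(ipC ip u x) !(ipC ip u x') !(ipC ip x' x) !(ipC ip w zt).
lra.
Qed.

Section OuterIteration.
Context {R : realType} {Z : normedModType R} (ip : {dot Z for idfun}).
Variables (f1 f2 : Z -> R) (h : Z -> \bar R) (m1 M1 m2 M2 : R).
Variables (Omega : set Z) (rho lambda theta : R).
Hypothesis fdip : fin_dim_inner_product ip.
Hypotheses (ch : Conv h) (f2C1 : C1 ip f2).
Hypothesis lip_f2 : lip_grad ip f2 (Lip m2 M2) (dom h) (dom h).
Hypotheses (dom_closed : closed (dom h)) (domO : dom h `<=` Omega).
Hypotheses (O_bounded : bounded_set Omega) (O_proj : has_projection Omega).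
Hypothesis curv_f1 : curvature ip f1 m1 M1 (dom h) Omega.
Hypothesis lip_f1 : lip_grad ip f1 (Lip m1 M1) (dom h) Omega.
Hypotheses (lambda0 : 0 < lambda) (theta01 : 0 < theta < 1).
Hypothesis step_size : lambda * M1 + theta ^+ 2 <= 1 / 2.
Hypothesis input : forall z0, racg_input ip 1 (da_M lambda M2)
  (da_psis ip f1 f2 lambda z0) (da_psin h lambda).

Hypothesis rho0 : 0 < rho.

Let ip_norm : forall x, `|x| = Num.sqrt (ip x x) := fdip.1.
Let psisC1 z0 : C1 ip (da_psis ip f1 f2 lambda z0). Proof. by case: (input z0). Qed.

Let gradE := grad_da_psis ip_norm f2C1 psisC1.

Local Notation M := (da_M lambda M2).
Local Notation psis := (da_psis ip f1 f2 lambda).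
Local Notation psin := (da_psin h lambda).
Local Notation iter := (da_iter ip f1 f2 h lambda M2 Omega theta rho).
Local Notation m1p := (Num.max m1 0).
Local Notation E := (Econst lambda theta m1 M1 m2 M2).

Implicit Types s : @da_state R Z.

Definition rphi u : R := f1 u + f2 u + fine (h u).

Lemma phiE u : dom h u -> phi f1 f2 h u = (rphi u)%:E.
Proof. by move=> hu; rewrite /phi (Conv_fineK ch hu) -EFinD. Qed.

Lemma diam_le (S : set Z) u z : bounded_set S -> S u -> S z -> `|u - z| <= diam S.
Proof.
move=> /ex_strict_bound_gt0 [r r0 Sr] Su Sz.
apply: ub_le_sup; last by exists u => //; exists z.
exists (r + r) => _ [u' Su' [z' Sz' <-]].
by rewrite (le_trans (ler_normB _ _))// lerD// ltW//; exact: Sr.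
Qed.

Lemma dom_bounded : bounded_set (dom h).
Proof.
by case: O_bounded => r [rr Hr]; exists r; split => // x /Hr Hx u /domO; exact: Hx.
Qed.

Lemma dom_compact : compact (dom psin).
Proof.
rewrite dom_da_psin//.
exact: (closed_bounded_compact ip_norm fdip.2 dom_closed dom_bounded).
Qed.

Definition da_inv s :=
  [/\ 0 <= dA s, Omega (dx s) & dom h (dy s)].

(** As [a^2] is the next value of [A], the third clause is the induction step for
    [k^2 / 4 <= A_k <= k^2]. *)
Lemma da_aP s : 0 <= dA s ->
  [/\ 1 <= da_a s, da_a s ^+ 2 = dA s + da_a s &
      forall k, 0 <= k -> (k ^+ 2 <= 4 * dA s -> k + 1 <= 2 * da_a s) /\
        (dA s <= k ^+ 2 -> da_a s <= k + 1)].
Proof.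
move=> A0; rewrite /da_a; set q := Num.sqrt _.
have qq : q ^+ 2 = 1 + 4 * dA s by rewrite sqr_sqrtr//; lra.
have q0 : 0 <= q by exact: sqrtr_ge0.
have q1 : 1 <= q by rewrite -(ler_pXn2r (n := 2)) ?nnegrE// expr1n qq; lra.
split; [lra|by rewrite exprMn sqrrD qq; field|move=> k k0; split=> kA].
  have : k <= q by rewrite -(ler_pXn2r (n := 2)) ?nnegrE// qq; lra.
  lra.
have : q <= 1 + 2 * k.
  rewrite -(ler_pXn2r (n := 2)) ?nnegrE// ?qq ?sqrrD ?exprMn; lra.
lra.
Qed.

Lemma da_xtE s : 0 <= dA s ->
  (dA s + da_a s) *: da_xt s = dA s *: dy s + da_a s *: dx s.
Proof.
move=> A0; have [a1 _ _] := da_aP A0.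
by rewrite /da_xt scalerA mulfV ?scale1r// gt_eqF//; lra.
Qed.

Lemma da_xt_conv s : 0 <= dA s ->
  let t := dA s / (dA s + da_a s) in 0 <= t <= 1 /\
  da_xt s = t *: dy s + (1 - t) *: dx s.
Proof.
move=> A0 t; have [a1 _ _] := da_aP A0.
have A'0 : 0 < dA s + da_a s by lra.
split; first by rewrite divr_ge0 ?(ltW A'0)//= ler_pdivrMr// mul1r; lra.
have -> : 1 - t = da_a s / (dA s + da_a s).
  by rewrite /t; field; rewrite gt_eqF.
by rewrite /da_xt scalerDr !scalerA /t !(mulrC _^-1).
Qed.

Lemma da_xt_Omega s : da_inv s -> Omega (da_xt s).
Proof.
move=> [A0 Ox dy0]; have [t01 ->] := da_xt_conv A0.
by apply: (has_projection_convex fdip) => //; exact: domO.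
Qed.

Lemma da_xt_dist_dy s : 0 <= dA s ->
  (dA s + da_a s) * `|dy s - da_xt s| ^+ 2 = `|dy s - dx s| ^+ 2.
Proof.
move=> A0; have [a1 aa _] := da_aP A0.
have A'0 : dA s + da_a s != 0 by rewrite gt_eqF//; lra.
have e : (dA s + da_a s) *: (dy s - da_xt s) = da_a s *: (dy s - dx s).
  rewrite scalerBr da_xtE// scalerDl scalerBr opprD addrACA subrr add0r.
  by [].
have := congr1 (fun v => `|v| ^+ 2) e; rewrite /= !sqr_normZ aa => ee.
by apply: (mulfI A'0); rewrite mulrA -expr2.
Qed.

(** In [xt = t y + (1 - t) x] the weights satisfy [a (1 - t) = 1]. After multiplication by [a], only
    the distance to [y], which lies in [dom h], keeps the growing factor. *)
Lemma da_xt_dist s u : 0 <= dA s ->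
  da_a s * `|u - da_xt s| ^+ 2 <= da_a s * `|u - dy s| ^+ 2 + `|u - dx s| ^+ 2.
Proof.
move=> A0; have [a1 aa _] := da_aP A0; have [/andP[t0 t1] ->] := da_xt_conv A0.
set t := _ / _ in t0 t1 *.
have -> : u - (t *: dy s + (1 - t) *: dx s) = t *: (u - dy s) + (1 - t) *: (u - dx s).
  by apply: (ip_inj ip_norm) => w; rewrite !ipE; ring.
rewrite (sqr_norm_conv ip_norm).
have at1 : da_a s * (1 - t) = 1.
  have A'0 : dA s + da_a s != 0 by rewrite gt_eqF//; lra.
  have -> : 1 - t = da_a s / (dA s + da_a s) by rewrite /t; field.
  by rewrite mulrA -expr2 aa divff.
have n0 := exprn_ge0 2 (normr_ge0 (u - dy s)).
have n1 : 0 <= da_a s * (t * (1 - t) * `|u - dy s - (u - dx s)| ^+ 2).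
  by apply: mulr_ge0; [lra|rewrite mulr_ge0 ?sqr_ge0// mulr_ge0//; lra].
have n2 : da_a s * t * `|u - dy s| ^+ 2 <= da_a s * `|u - dy s| ^+ 2.
  by apply: ler_wpM2r => //; rewrite ler_piMr//; lra.
rewrite !mulrDr mulrN (mulrA (da_a s) (1 - t)) at1; lra.
Qed.

Lemma sqrt_lambda_Econst :
  Num.sqrt lambda * E = lambda * Lip m1 M1 + 1 + theta * Cbar lambda m1 M1 m2 M2.
Proof.
have l0 : 0 < Num.sqrt lambda by rewrite sqrtr_gt0.
rewrite /Econst; move: (Cbar _ _ _ _ _) => C; rewrite -{4}(sqr_sqrtr (ltW lambda0)).
by field; rewrite gt_eqF.
Qed.

Lemma Lip_ge0 m M' : 0 <= Lip m M' :> R.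
Proof. by rewrite /Lip le_max normr_ge0. Qed.

Lemma Cbar_ge0 : 0 <= Cbar lambda m1 M1 m2 M2.
Proof.
rewrite /Cbar divr_ge0 ?sqrtr_ge0// addr_ge0// mulr_ge0 ?(ltW lambda0)//.
by rewrite !addr_ge0 ?Lip_ge0// le_max lexx orbT.
Qed.

Lemma Econst_gt0 : 0 < E.
Proof.
have l0 : 0 < Num.sqrt lambda by rewrite sqrtr_gt0.
have /andP[t0 _] := theta01.
rewrite -(pmulr_rgt0 _ l0) sqrt_lambda_Econst.
have := mulr_ge0 (ltW lambda0) (Lip_ge0 m1 M1); have := mulr_ge0 (ltW t0) Cbar_ge0; lra.
Qed.

(** The origin of [E]: in [lambda vh], the terms in [|yh - y|] collect into [theta * Cbar], the
    gradient of [f1] adds [lambda L1], and the prox shift adds [1]. The factor 2 absorbs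
    [|v| <= theta |y - zt|]. *)
Lemma SRP_norm zt y v eps yh vh : Omega zt -> dom h y -> 0 <= eps ->
  `|v| ^+ 2 + 2 * eps <= theta ^+ 2 * `|y - zt| ^+ 2 ->
  (forall yr vr, RP ip M (psis zt) psin y v yr vr ->
     (M + 1) / 2 * `|yr - y| ^+ 2 <= eps) ->
  SRP ip f1 f2 h lambda M2 y v zt yh vh ->
  Num.sqrt lambda * `|vh| <= 2 * E * `|y - zt|.
Proof.
move=> Oz dy e0 c4 rpd [vr [rp vhE]].
have [dyh _] := RP_subgradient ip_norm (input zt) rp; rewrite dom_da_psin// in dyh.
have D := rpd _ _ rp; case: rp => _ vrE.
have l0 : 0 < Num.sqrt lambda by rewrite sqrtr_gt0.
have /andP[t0 t1] := theta01.
have lip1 := lip_f1 dyh Oz; have lip2 := lip_f2 dyh dy.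
pose K := 1 + lambda * Num.max M2 0.
have max0 : 0 <= lambda * Num.max M2 0.
  by rewrite mulr_ge0 ?(ltW lambda0)// le_max lexx orbT.
have K1 : 1 <= K by rewrite /K; lra.
have sK0 : 0 < Num.sqrt K by rewrite sqrtr_gt0; lra.
(* Here [K] equals [M], and the refinement bound gives [K |yh - y|^2 <= 2 eps <= theta^2 |y -
   zt|^2]; hence the square root in the denominator of [Cbar]. *)
have yhy : Num.sqrt K * `|yh - y| <= theta * `|y - zt|.
  rewrite -(ler_pXn2r (n := 2)) ?nnegrE ?mulr_ge0 ?(ltW sK0) ?(ltW t0)//.
  rewrite !exprMn sqr_sqrtr; last lra.
  have := exprn_ge0 2 (normr_ge0 v); have := exprn_ge0 2 (normr_ge0 (yh - y)).
  by move: D c4; rewrite /da_M /K; lra.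
have vy : `|v| <= theta * `|y - zt|.
  rewrite -(ler_pXn2r (n := 2)) ?nnegrE ?mulr_ge0 ?(ltW t0)// exprMn; lra.
have vE : lambda *: vh = v + (lambda * Num.max M2 0) *: (y - yh)
    + lambda *: (grad ip f2 yh - grad ip f2 y) + (zt - y) + (y - yh)
    + lambda *: (grad ip f1 yh - grad ip f1 zt).
  apply: (ip_inj ip_norm) => w; rewrite vhE vrE !gradE /da_M.
  move: (grad ip f1 zt) (grad ip f1 yh) (grad ip f2 y) (grad ip f2 yh) => G1 G2 G3 G4.
  rewrite !ipE; field.
  by rewrite gt_eqF.
have tri : lambda * `|vh| <= `|v| + lambda * Num.max M2 0 * `|yh - y|
    + lambda * `|grad ip f2 yh - grad ip f2 y| + `|y - zt| + `|yh - y|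
    + lambda * `|grad ip f1 yh - grad ip f1 zt|.
  rewrite -[lambda in leLHS](gtr0_norm lambda0) -normrZ vE.
  have normB x z : `|x - z : Z| <= `|z - x| by rewrite distrC.
  have normZ (k : R) (x : Z) : 0 <= k -> `|k *: x| <= k * `|x|.
    by move=> k0; rewrite normrZ ger0_norm.
  do 5 (apply: (le_trans (ler_normD _ _)); apply: lerD; last first;
    first by first [exact: normB | exact: (normZ _ _ (ltW lambda0))
      | apply: (le_trans (normZ _ _ max0)); rewrite distrC]).
  exact: lexx.
have yhz : `|yh - zt| <= `|yh - y| + `|y - zt|.
  by rewrite (le_trans _ (ler_normD _ _))// addrA subrK.
have L1 := ler_wpM2l (Lip_ge0 m1 M1) yhz.
have lip1' : lambda * `|grad ip f1 yh - grad ip f1 zt| <=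
    lambda * (Lip m1 M1 * (`|yh - y| + `|y - zt|)).
  by rewrite ler_pM2l//; lra.
have lip2' : lambda * `|grad ip f2 yh - grad ip f2 y| <=
    lambda * (Lip m2 M2 * `|yh - y|) by rewrite ler_pM2l.
have CK : (1 + lambda * (Num.max M2 0 + Lip m1 M1 + Lip m2 M2)) * `|yh - y| <=
    Cbar lambda m1 M1 m2 M2 * (theta * `|y - zt|).
  apply: le_trans (ler_wpM2l Cbar_ge0 yhy).
  by rewrite mulrA /Cbar -/K divfK// gt_eqF.
rewrite -(ler_pM2l l0) mulrA -expr2 sqr_sqrtr ?(ltW lambda0)//.
have -> : Num.sqrt lambda * (2 * E * `|y - zt|) =
    2 * (Num.sqrt lambda * E) * `|y - zt| by ring.
rewrite sqrt_lambda_Econst.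
have dz : 0 <= `|y - zt| by [].
have := mulr_ge0 (mulr_ge0 (ltW lambda0) (Lip_ge0 m1 M1)) dz.
have := mulr_ge0 (mulr_ge0 (ltW t0) Cbar_ge0) dz.
have := ler_wpM2r dz (ltW t1).
by lra.
Qed.

(** The formula for [vh] removes the prox term and trades the gradient of [f1] at [zt] for the one
    at [yh]. What remains is the subgradient of [lambda h] from [RP_subgradient], divided by
    [lambda]. *)
Lemma SRP_subdiff zt y v yh vh : SRP ip f1 f2 h lambda M2 y v zt yh vh ->
  [set grad ip f1 yh + grad ip f2 yh + s | s in subdiff ip h yh] vh.
Proof.
move=> [vr [rp ->]].
have [dyh sub] := RP_subgradient ip_norm (input zt) rp.
rewrite dom_da_psin// in dyh sub.
exists (lambda^-1 *: (vr - grad ip (psis zt) yh)); last first.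
  apply: (ip_inj ip_norm) => w; rewrite !gradE.
  move: (grad ip f1 zt) (grad ip f1 yh) (grad ip f2 yh) => G1 G2 G3.
  rewrite !ipE; field.
  by rewrite gt_eqF.
move=> u; have [du|/dom_notin ->] := pselect (dom h u); last by rewrite leey.
have := sub u du; rewrite !fine_da_psin// (Conv_fineK ch du) (Conv_fineK ch dyh).
rewrite -EFinD lee_fin ipZl -(ler_pM2l lambda0) => H.
by move: H; rewrite mulrDr mulVKf ?gt_eqF.
Qed.

Lemma outer_step s ya v eps x' : da_inv s -> dom h ya ->
  `|v| ^+ 2 + 2 * eps <= theta ^+ 2 * `|ya - da_xt s| ^+ 2 ->
  is_argmin Omega
    (fun u => 1 / 2 * `|u - (dx s - da_a s *: (v + da_xt s - ya))| ^+ 2) x' ->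
  exists gbar : Z -> R,
    (forall u, dom h u -> da_Delta ip f1 f2 h lambda s u ya v <= eps ->
       gbar u <= lambda * rphi u + lambda * m1p / 2 * `|u - da_xt s| ^+ 2) /\
    (forall u, Omega u ->
       (dA s + da_a s) * (lambda * rphi ya + 1 / 4 * `|ya - da_xt s| ^+ 2)
         + 1 / 2 * `|u - x'| ^+ 2 <=
       dA s * gbar (dy s) + da_a s * gbar u + 1 / 2 * `|u - dx s| ^+ 2).
Proof.
move=> inv dya c4 x'P; have Oz := da_xt_Omega inv.
have [A0 Ox ddy] := inv; have [a1 aa _] := da_aP A0.
(* In [gbar] the two squares differ by an affine function; [c] is its value
   [psi y - |y - zt|^2 / 2 - eps] at [ya], and [g] its slope. *)
pose c := lambda * (lin ip f1 ya (da_xt s) + f2 ya + fine (h ya)) - eps.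
pose g := v + da_xt s - ya.
exists (fun u => c + ip g (u - ya)); split=> [u du|u Ou].
  have /andP[lo _] := curv_f1 du Oz.
  have m1le : - (m1p / 2) * `|u - da_xt s| ^+ 2 <= - (m1 / 2) * `|u - da_xt s| ^+ 2.
    by rewrite ler_wpM2r ?exprn_ge0// lerN2 ler_pM2r ?invr_gt0// le_max lexx.
  have /(ler_wpM2l (ltW lambda0)) := le_trans m1le lo.
  rewrite /da_Delta /Delta /psi /da_psis !fine_da_psin// /c /g /rphi.
  move: (lin ip f1 u (da_xt s)) (lin ip f1 ya (da_xt s)) => lu ly.
  move: (da_xt s) => zt; rewrite !(sqr_norm ip_norm) !ipE.
  rewrite ?(ipC ip u zt) ?(ipC ip ya zt) ?(ipC ip u ya); lra.
apply: (accel_step ip_norm A0 a1 aa (da_xtE A0) (v := v)).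
  (* Passing from the linearization to [f1] costs [lambda M1 / 2 |ya - zt|^2], while
     [eps + |v|^2 / 2] costs [theta^2 / 2 |ya - zt|^2]. By [step_size] the total is at most a
     quarter, so a quarter is left of the half provided. *)
  have /andP[_ up] := curv_f1 dya Oz.
  have /(ler_wpM2l (ltW lambda0)) := up.
  have /(ler_wpM2r (exprn_ge0 2 (normr_ge0 (ya - da_xt s)))) := step_size.
  by move: c4; rewrite /c /rphi; lra.
exact: (argmin_proj ip_norm (has_projection_convex fdip O_proj O_bounded) x'P).
Qed.

Local Notation racg_out := (da_racg ip f1 f2 h lambda M2 theta).
Local Notation DOmega := (diam Omega).
Local Notation Dh := (diam (dom h)).

Lemma da_racg_output s ya v eps : racg_out s (Some (ya, v, eps)) ->
  [/\ dom h ya, 0 <= eps,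
      `|v| ^+ 2 + 2 * eps <= theta ^+ 2 * `|ya - da_xt s| ^+ 2 &
      forall yr vr, RP ip M (psis (da_xt s)) psin ya v yr vr ->
        (M + 1) / 2 * `|yr - ya| ^+ 2 <= eps].
Proof.
by move=> /(racg_output ip_norm (input (da_xt s))); rewrite dom_da_psin.
Qed.

Lemma da_iter_exists s : da_inv s -> exists o, iter s o.
Proof.
move=> inv; have [r rP] :=
  racg_terminates ip_norm (da_xt s) (input (da_xt s)) theta01 dom_compact.
case: r rP => [[[ya v] eps]|] rP; last by exists Failure; exact: da_fail2.
have [D|D] := pselect (da_Delta ip f1 f2 h lambda s (dy s) ya v <= eps); last first.
  by exists Failure; exact: da_fail3 rP D.
have [yh [vr rp]] := RP_exists ip_norm (input (da_xt s)) ya v dom_compact.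
pose vh := lambda^-1 *: (vr + da_xt s - yh) + grad ip f1 yh - grad ip f1 (da_xt s).
have srp : SRP ip f1 f2 h lambda M2 ya v (da_xt s) yh vh by exists vr.
have [small|large] := pselect (`|vh| <= rho).
  by exists (Success (yh, vh)); exact: da_success rP D srp small.
have [x' [x'P _]] := O_proj (dx s - da_a s *: (v + da_xt s - ya)).
have [y' y'P] : exists y', is_argmin [set dy s; ya] (phi f1 f2 h) y'.
  case: (leP (phi f1 f2 h (dy s)) (phi f1 f2 h ya)) => le.
    by exists (dy s); split=> [|u [->|->]]//; left.
  by exists ya; split=> [|u [->|->]]//; [right|exact: ltW].
exists (Continue (DState (dA s + da_a s) x' y')).
exact: da_continue rP D srp large x'P y'P.
Qed.

Section ConvexF2.
Hypothesis f2cvx : convex_function (setT : set (convex_lmodType Z)) f2.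

Lemma da_racg_convex s o : racg_out s o ->
  exists ya v eps, o = Some (ya, v, eps) /\
    forall u, dom h u -> da_Delta ip f1 f2 h lambda s u ya v <= eps.
Proof.
have sc u y : 1 / 2 * `|u - y| ^+ 2 <=
    psis (da_xt s) u - lin ip (psis (da_xt s)) u y.
  rewrite (da_psis_lin ip_norm f2C1 psisC1) lerDr mulr_ge0 ?(ltW lambda0)//.
  by rewrite subr_ge0; exact: convex_grad_le.
by move=> /(racg_convex ip_norm (input (da_xt s)) sc); rewrite dom_da_psin.
Qed.

Lemma da_no_failure s : da_inv s -> ~ iter s Failure.
Proof.
move=> [_ _ ddy]; move oE : Failure => o it; case: it oE => //.
  by move=> /da_racg_convex [ya [v [eps []]]].
move=> ya v eps /da_racg_convex [ya' [v' [eps' [[-> -> ->] D]]]] nD.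
by case: nD; exact: D.
Qed.

End ConvexF2.

(** A quarter of the square of [rho * sqrt lambda / (2 * E)]: the guaranteed gain of a continuing
    iteration. *)
Definition progress : R := lambda * rho ^+ 2 / (16 * E ^+ 2).

Lemma progress_le vh d : 0 <= d -> rho < vh -> Num.sqrt lambda * vh <= 2 * E * d ->
  progress <= 1 / 4 * d ^+ 2.
Proof.
move=> d0 rvh; have E0 := Econst_gt0.
have l0 : 0 < Num.sqrt lambda by rewrite sqrtr_gt0.
move=> /(le_trans (ler_wpM2l (ltW l0) (ltW rvh))).
rewrite -(ler_pXn2r (n := 2)) ?nnegrE ?mulr_ge0 ?(ltW l0) ?(ltW E0) ?(ltW rho0)//.
rewrite !exprMn sqr_sqrtr ?(ltW lambda0)// => H.
rewrite /progress ler_pdivrMr; last by rewrite mulr_gt0// exprn_gt0.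
by lra.
Qed.

(** Only the affine model survives for the counting: [ya] is replaced by the better point [dy s'],
    and [|ya - xt|^2 / 4] by its lower bound [progress]. *)
Lemma da_continueP s s' : da_inv s -> iter s (Continue s') -> exists gbar : Z -> R,
  [/\ dA s' = dA s + da_a s /\ da_inv s',
      rphi (dy s') <= rphi (dy s),
      gbar (dy s) <= lambda * rphi (dy s) + lambda * m1p / 2 * `|dy s - da_xt s| ^+ 2,
      forall u, Omega u -> dA s' * (lambda * rphi (dy s') + progress)
          + 1 / 2 * `|u - dx s'| ^+ 2 <=
        dA s * gbar (dy s) + da_a s * gbar u + 1 / 2 * `|u - dx s| ^+ 2
    & convex_function (setT : set (convex_lmodType Z)) f2 -> forall u, dom h u ->
        gbar u <= lambda * rphi u + lambda * m1p / 2 * `|u - da_xt s| ^+ 2].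
Proof.
move=> inv; move oE : (Continue s') => o it; have [A0 Ox ddy] := inv.
case: it oE => // ya v eps yh vh x' y' rP D srp large x'P [y'S y'min] [s'E].
have [dya e0 c4 rpd] := da_racg_output rP.
have [gbar [gle gstep]] := outer_step inv dya c4 x'P.
have [a1 _ _] := da_aP A0.
have dy' : dom h y' by case: y'S => ->.
have pro : progress <= 1 / 4 * `|ya - da_xt s| ^+ 2.
  apply: (@progress_le `|vh|) => //; first by rewrite ltNge; apply/negP.
  exact: (SRP_norm (da_xt_Omega inv) dya e0 c4 rpd srp).
have y'y : rphi y' <= rphi (dy s).
  by have := y'min (dy s) (or_introl erefl); rewrite !phiE// lee_fin.
have y'ya : rphi y' <= rphi ya.
  by have := y'min ya (or_intror erefl); rewrite !phiE// lee_fin.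
exists gbar; rewrite s'E; split=> //=.
- by do !split=> //=; [lra|case: x'P].
- exact: gle D.
- move=> u /gstep; apply: le_trans; rewrite lerD2r ler_wpM2l//; first lra.
  by rewrite lerD// ler_pM2l.
- move=> f2cvx u du; apply: gle => //.
  by have [ya' [v' [eps' [[-> -> ->] D']]]] := da_racg_convex f2cvx rP; exact: D'.
Qed.

Lemma DOmega_ge u z : Omega u -> Omega z -> `|u - z| ^+ 2 <= DOmega ^+ 2.
Proof.
move=> Ou Oz; have H := diam_le O_bounded Ou Oz.
by rewrite ler_pXn2r ?nnegrE// (le_trans _ H).
Qed.

Lemma m1p_ge0 : 0 <= lambda * m1p / 2.
Proof. by rewrite divr_ge0// mulr_ge0 ?(ltW lambda0)// le_max lexx orbT. Qed.

(** The model is used only at [dy s], so its two weights add up to [dA s']. In the last term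
    [lambda * m1p] comes from [dA s' * |dy s - xt|^2 = |dy s - dx s|^2], and the [1] from the prox
    distance. *)
Lemma da_step_decrease s s' : da_inv s -> iter s (Continue s') ->
  dA s' * progress <= dA s' * (lambda * rphi (dy s) - lambda * rphi (dy s'))
    + (lambda * m1p + 1) / 2 * DOmega ^+ 2.
Proof.
move=> inv /(da_continueP inv) [gbar [[A'E _] _ gle gstep _]].
have [A0 Ox /domO Oy] := inv.
have := gstep _ Oy; have := da_xt_dist_dy A0; have := DOmega_ge Oy Ox.
have := ler_wpM2l (_ : 0 <= dA s') gle.
have := da_aP A0; rewrite -A'E => -[a1 _ _].
have A'0 : 0 <= dA s' by lra.
move=> /(_ A'0) H1 H2 H3 H4.
have := ler_wpM2l m1p_ge0 H2; have := exprn_ge0 2 (normr_ge0 (dy s - dx s')).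
have H5 := congr1 (fun t => lambda * m1p / 2 * t) H3.
have H6 := congr1 (fun t => t * gbar (dy s)) A'E.
by move: H1 H4 H5 H6 => /=; rewrite !mulrDl; lra.
Qed.

Lemma da_step_potential s s' u : da_inv s -> iter s (Continue s') ->
  convex_function (setT : set (convex_lmodType Z)) f2 -> dom h u ->
  dA s' * (lambda * rphi (dy s') - lambda * rphi u) + 1 / 2 * `|u - dx s'| ^+ 2
    + dA s' * progress <=
  dA s * (lambda * rphi (dy s) - lambda * rphi u) + 1 / 2 * `|u - dx s| ^+ 2
    + lambda * m1p / 2 * (2 * DOmega ^+ 2 + (dA s' - dA s) * Dh ^+ 2).
Proof.
move=> inv /(da_continueP inv) [gbar [[A'E _] _ gley gstep gleu]] f2cvx du.
have {gleu}gleu := gleu f2cvx u du.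
have [A0 Ox dy0] := inv; have Oy := domO dy0; have Ou := domO du.
have [a1 _ _] := da_aP A0; have a0 : 0 <= da_a s by lra.
have Dhu : `|u - dy s| ^+ 2 <= Dh ^+ 2.
  have H := diam_le dom_bounded du dy0.
  by rewrite ler_pXn2r ?nnegrE// (le_trans _ H).
have H1 := gstep u Ou.
have H2 := ler_wpM2l A0 gley; have H3 := ler_wpM2l a0 gleu.
have H4 := da_xt_dist u A0; have H5 := da_xt_dist_dy A0.
have H6 := DOmega_ge Oy Ox; have H7 := DOmega_ge Ou Ox.
have H8 := ler_wpM2l a0 Dhu.
have H9 := mulr_ge0 a0 (exprn_ge0 2 (normr_ge0 (dy s - da_xt s))).
(* Two distances in [Omega] enter without a growing factor. Only [|u - dy s|], between points of
   [dom h], is weighted by [a], and these weights sum to [A_n]; hence [Dh] goes with [n^2] and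
   [DOmega] with [n]. *)
have H10 : da_a s * `|u - da_xt s| ^+ 2 + dA s * `|dy s - da_xt s| ^+ 2 <=
    2 * DOmega ^+ 2 + da_a s * Dh ^+ 2 by lra.
have := ler_wpM2l m1p_ge0 H10; move: H1 H2 H3; rewrite A'E.
move: (lambda * rphi (dy s)) (lambda * rphi (dy s')) (lambda * rphi u) => p p' pu.
move: (lambda * m1p / 2) => k; lra.
Qed.

(** * Bounds on the length of a chain of continuing outer iterations *)

Section Runs.
Variable y0 : Z.
Hypothesis dy0 : dom h y0.

Lemma da_inv_init : da_inv (da_init y0).
Proof. by split=> //=; exact: domO. Qed.

Lemma da_inv_step s s' : da_inv s -> iter s (Continue s') -> da_inv s'.
Proof. by move=> inv /(da_continueP inv) [gbar [[]]]. Qed.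

Lemma chain_run n x : chain iter n (da_init y0) x -> forall i, (i <= n)%N ->
  [/\ da_inv (x i), i%:R ^+ 2 <= 4 * dA (x i), dA (x i) <= i%:R ^+ 2 &
      rphi (dy (x i)) <= rphi y0].
Proof.
move=> [x0 xS]; elim=> [_|i IH lt_in].
  by rewrite x0 /= expr0n mulr0; split=> //; exact: da_inv_init.
have [inv lo hi le] := IH (ltnW lt_in).
have [gbar [[A'E inv'] le' _ _ _]] := da_continueP inv (xS i lt_in).
have [A0 _ _] := inv.
have [a1 aa /(_ i%:R (ler0n _ _)) [/(_ lo) ge /(_ hi) le2]] := da_aP A0.
have i0 : 0 <= i%:R :> R by [].
split=> //; last exact: le_trans le' le.
- rewrite A'E -aa -natr1.
  have : (i%:R + 1) ^+ 2 <= (2 * da_a (x i)) ^+ 2 by rewrite ler_pXn2r ?nnegrE//; lra.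
  by rewrite exprMn; lra.
- by rewrite A'E -aa -natr1 ler_pXn2r ?nnegrE//; lra.
Qed.

Variable us : Z.
Hypothesis dus : dom h us.
Hypothesis us_min : forall u, dom h u -> rphi us <= rphi u.

Let r : R := E / rho.
Let r0 : 0 < r. Proof. by rewrite divr_gt0// Econst_gt0. Qed.

Let progressE : 16 * r ^+ 2 * progress = lambda.
Proof.
by rewrite /progress /r; field; rewrite !gt_eqF// Econst_gt0.
Qed.

Let progress_gt0 : 0 < progress.
Proof. by rewrite /progress divr_gt0// mulr_gt0// exprn_gt0// Econst_gt0. Qed.

Lemma chain_length n x : (0 < n)%N -> chain iter (n + n) (da_init y0) x ->
  n%:R <= 32 * (E ^+ 2 * (m1p * Dh ^+ 2 + (rphi y0 - rphi us)) / rho ^+ 2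
                + E * Num.sqrt (m1p + 1 / lambda) * DOmega / rho).
Proof.
move=> n0 xP; have run := chain_run xP.
pose W := (lambda * m1p + 1) / 2 * DOmega ^+ 2.
have m1p0 : 0 <= m1p by rewrite le_max lexx orbT.
have DO0 : 0 <= DOmega.
  by have := diam_le O_bounded (domO dy0) (domO dy0); rewrite subrr normr0.
have W0 : 0 <= W.
  by rewrite mulr_ge0 ?exprn_ge0// divr_ge0// addr_ge0// mulr_ge0 ?(ltW lambda0).
have sum : n%:R ^+ 2 * progress <= n%:R * (lambda * rphi (dy (x n)) -
    lambda * rphi (dy (x (n + n)%N))) + 4 * W.
  apply: (window_sum (A := dA \o x) (p := fun i => lambda * rphi (dy (x i)))) => //.
    by move=> i /run [].
  move=> i lt_i; have [inv _ _ _] := run i (ltnW lt_i).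
  by apply: da_step_decrease => //; have [_] := xP; exact.
have [_ _ _ len] := run n (leq_addl _ _).
have [[_ _ /us_min ge2] _ _ _] := run _ (leqnn (n + n)%N).
have nn : 0 < n%:R :> R by rewrite ltr0n.
have {}sum : n%:R ^+ 2 * progress <= n%:R * (lambda * (rphi y0 - rphi us)) + 4 * W.
  apply: le_trans sum _; rewrite lerD2r ler_pM2l// -mulrBr ler_pM2l//; lra.
set T1 := E ^+ 2 * _ / _; set T2 := E * _ * _ / _.
have T1E : T1 = r ^+ 2 * (m1p * Dh ^+ 2) + r ^+ 2 * (rphi y0 - rphi us).
  by rewrite /T1 /r; field; rewrite gt_eqF.
have T2E : T2 ^+ 2 = r ^+ 2 * (m1p + 1 / lambda) * DOmega ^+ 2.
  have sq : Num.sqrt (m1p + 1 / lambda) ^+ 2 = m1p + 1 / lambda.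
    by rewrite sqr_sqrtr// addr_ge0// divr_ge0// ltW.
  by rewrite -sq /T2 /r; field; rewrite gt_eqF.
have T2_ge0 : 0 <= T2.
  by rewrite /T2 !mulr_ge0 ?sqrtr_ge0 ?invr_ge0 ?(ltW rho0)// (ltW Econst_gt0).
have T1ge : r ^+ 2 * (rphi y0 - rphi us) <= T1.
  rewrite T1E lerDr; apply: mulr_ge0; rewrite ?sqr_ge0//.
  by apply: mulr_ge0; rewrite ?sqr_ge0.
have D0 : 0 <= r ^+ 2 * (rphi y0 - rphi us).
  by rewrite mulr_ge0 ?exprn_ge0 ?(ltW r0)// subr_ge0 us_min.
(* Multiplication by [16 r^2] turns [progress] into [lambda], and [4 W] into [32 lambda T2^2]. *)
have quad : n%:R ^+ 2 <= 16 * n%:R * (r ^+ 2 * (rphi y0 - rphi us)) + 32 * T2 ^+ 2.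
  rewrite -(ler_pM2l lambda0) -{1}progressE.
  have -> : 16 * r ^+ 2 * progress * n%:R ^+ 2 = 16 * r ^+ 2 * (n%:R ^+ 2 * progress).
    by ring.
  have /ler_wpM2l : 0 <= 16 * r ^+ 2 by rewrite mulr_ge0// exprn_ge0// ltW.
  move=> /(_ _ _ sum) /le_trans; apply.
  rewrite le_eqVlt; apply/orP; left; apply/eqP; rewrite T2E /W; field.
  by rewrite gt_eqF.
clear T1E T2E; clearbody T1 T2; move: (r ^+ 2 * _) D0 T1ge quad => T D0 T1ge quad.
rewrite leNgt; apply/negP => nX.
(* With [T] and [T2] below [n / 32], the right side of [quad] is at most [(1/2 + 1/32) n^2]. *)
have t1 : T <= n%:R / 32 by lra.
have t2 : T2 ^+ 2 <= (n%:R / 32) ^+ 2 by rewrite ler_pXn2r ?nnegrE//; lra.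
have := ler_wpM2l (ltW nn) t1; have := exprn_gt0 2 nn.
by lra.
Qed.

Hypothesis f2cvx : convex_function (setT : set (convex_lmodType Z)) f2.

(** The minimizer [us] is confined to the right-hand side and is arbitrary, so that the infimum [d0]
    can be taken afterwards without a nearest minimizer. The constant [192] is [12 * 16], from
    [potential_sum] and [progressE]. *)
Lemma convex_chain_length n x : chain iter n (da_init y0) x ->
  n%:R ^+ 3 - 192 * (n%:R * (E * Num.sqrt m1p * DOmega / rho) ^+ 2
     + n%:R ^+ 2 * (E ^+ 2 * m1p * Dh ^+ 2 / rho ^+ 2) / 2)
  <= 96 * (r ^+ 2 / lambda) * `|y0 - us| ^+ 2.
Proof.
move=> xP; have run := chain_run xP.
pose F i := dA (x i) * (lambda * rphi (dy (x i)) - lambda * rphi us)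
  + 1 / 2 * `|us - dx (x i)| ^+ 2.
have m1p0 : 0 <= m1p by rewrite le_max lexx orbT.
have x0 : x 0%N = da_init y0 by case: xP.
have sum : progress * n%:R ^+ 3 / 12 + F n <= F 0%N +
   lambda * m1p / 2 * (2 * n%:R * DOmega ^+ 2 + dA (x n) * Dh ^+ 2).
  apply: (potential_sum (A := dA \o x)); rewrite /= ?x0 ?(ltW progress_gt0)//.
    by move=> i /run [].
  move=> i lt_i; have [inv _ _ _] := run i (ltnW lt_i).
  by apply: da_step_potential => //; have [_] := xP; exact.
have [[An0 _ /us_min len] _ Anle _] := run n (leqnn n).
have Fn : 0 <= F n.
  rewrite addr_ge0// mulr_ge0// ?exprn_ge0//.
  by rewrite -mulrBr mulr_ge0 ?subr_ge0 ?(ltW lambda0).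
have F0 : F 0%N = 1 / 2 * `|y0 - us| ^+ 2 by rewrite /F x0 /= mul0r add0r distrC.
have Dh0 : 0 <= Dh.
  by have := diam_le dom_bounded dy0 dy0; rewrite subrr normr0.
have A_le := ler_wpM2r (exprn_ge0 2 Dh0) Anle.
have sum2 : progress * n%:R ^+ 3 / 12 <= 1 / 2 * `|y0 - us| ^+ 2 +
   lambda * m1p / 2 * (2 * n%:R * DOmega ^+ 2 + n%:R ^+ 2 * Dh ^+ 2).
  have : lambda * m1p / 2 * (2 * n%:R * DOmega ^+ 2 + dA (x n) * Dh ^+ 2) <=
      lambda * m1p / 2 * (2 * n%:R * DOmega ^+ 2 + n%:R ^+ 2 * Dh ^+ 2).
    by rewrite ler_wpM2l ?m1p_ge0// lerD2l.
  by move: sum; rewrite F0; lra.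
have sqm : Num.sqrt m1p ^+ 2 = m1p by rewrite sqr_sqrtr.
have -> : (E * Num.sqrt m1p * DOmega / rho) ^+ 2 = r ^+ 2 * m1p * DOmega ^+ 2.
  by rewrite -{2}sqm /r; field; rewrite gt_eqF.
have -> : E ^+ 2 * m1p * Dh ^+ 2 / rho ^+ 2 = r ^+ 2 * m1p * Dh ^+ 2.
  by rewrite /r; field; rewrite gt_eqF.
rewrite -(ler_pM2l lambda0).
have -> : lambda * (96 * (r ^+ 2 / lambda) * `|y0 - us| ^+ 2) =
  96 * r ^+ 2 * `|y0 - us| ^+ 2 by field; rewrite gt_eqF.
have /ler_wpM2l : 0 <= 192 * r ^+ 2 by rewrite mulr_ge0// exprn_ge0// ltW.
move=> /(_ _ _ sum2); have := congr1 (fun t => t * n%:R ^+ 3) progressE.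
by move: (progress) (r) => q r1 /=; lra.
Qed.

End Runs.

End OuterIteration.

Section PowerLemmas.
Context {R : realType}.

Lemma powR_two_thirds_cube (x : R) : 0 <= x -> (x `^ (2 / 3)) ^+ 3 = x ^+ 2.
Proof.
move=> x0; rewrite -powR_mulrn ?powR_ge0// -powRrM.
have -> : 2 / 3 * 3%:R = 2%:R :> R by field.
by rewrite powR_mulrn.
Qed.

Lemma powR_minus_third_cube (x : R) : 0 <= x -> (x `^ (- (1 / 3))) ^+ 3 = x^-1.
Proof.
move=> x0; rewrite -powR_mulrn ?powR_ge0// -powRrM.
have -> : - (1 / 3) * 3%:R = - 1 :> R by field.
by rewrite powR_inv1.
Qed.

End PowerLemmas.

(** Carries the bound from each minimizer to the infimum [d0]. In that use [t] is a difference and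
    may be negative; if it is positive, its square root is a lower bound of [S]. *)
Lemma le_sqr_inf (R : realType) (S : set R) (t : R) : S !=set0 ->
  (forall d, S d -> 0 <= d /\ t <= d ^+ 2) -> t <= inf S ^+ 2.
Proof.
move=> S0 H; have [t0|t0] := leP t 0; first exact: le_trans t0 (sqr_ge0 _).
rewrite -(sqr_sqrtr (ltW t0)); have sq : Num.sqrt t <= inf S.
  apply: lb_le_inf => // d /H [d0 td].
  by rewrite -(ler_pXn2r (n := 2)) ?nnegrE ?sqrtr_ge0// sqr_sqrtr// ltW.
by rewrite ler_pXn2r ?nnegrE ?sqrtr_ge0// (le_trans _ sq)// sqrtr_ge0.
Qed.

Theorem theorem5 (R : realType) :
  exists C : R, 0 < C /\
  forall (Z : normedModType R) (ip : {dot Z for idfun})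
    (f1 f2 : Z -> R) (h : Z -> \bar R) (m1 M1 m2 M2 : R)
    (Omega : set Z) (rho : R) (y0 : Z) (lambda theta : R),
  fin_dim_inner_product ip ->
  Conv h ->
  C1 ip f1 -> C1 ip f2 ->
  curvature ip f1 m1 M1 (dom h) (dom h) ->
  curvature ip f2 m2 M2 (dom h) (dom h) ->
  lip_grad ip f1 (Lip m1 M1) (dom h) (dom h) ->
  lip_grad ip f2 (Lip m2 M2) (dom h) (dom h) ->
  (-oo < phi_star f1 f2 h)%E ->
  closed (dom h) ->
  dom h `<=` Omega -> bounded_set Omega -> has_projection Omega ->
  (* f1 is linearized at points of Omega, possibly outside dom h; void when
     Omega = dom h *)
  curvature ip f1 m1 M1 (dom h) Omega ->
  lip_grad ip f1 (Lip m1 M1) (dom h) Omega ->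
  0 < rho -> dom h y0 ->
  0 < lambda -> 0 < theta < 1 -> lambda * M1 + theta ^+ 2 <= 1 / 2 ->
  (* the inputs passed to R-ACG are admissible *)
  (forall z0, racg_input ip 1 (da_M lambda M2)
                (da_psis ip f1 f2 lambda z0) (da_psin h lambda)) ->
  let m1p := Num.max m1 0 in
  let Dh := diam (dom h) in
  let DO := diam Omega in
  let Dphi := fine (phi f1 f2 h y0 - phi_star f1 f2 h)%E in
  let d0 := dist_argmin f1 f2 h y0 in
  let E := Econst lambda theta m1 M1 m2 M2 in
  let iter := da_iter ip f1 f2 h lambda M2 Omega theta rho in
  [/\ exists N : nat,
        N%:R <= C * (1 + (E ^+ 2 * (m1p * Dh ^+ 2 + Dphi) / rho ^+ 2
                          + E * Num.sqrt (m1p + 1 / lambda) * DO / rho)) /\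
        stops_within iter N (da_init y0),
      forall yh vh : Z, returns iter (da_init y0) (Some (yh, vh)) ->
        [set grad ip f1 yh + grad ip f2 yh + s | s in subdiff ip h yh] vh /\
        `|vh| <= rho
    & convex_function (setT : set (convex_lmodType Z)) f2 ->
      exists N : nat,
        N%:R <= C * (1 + (E ^+ 2 * m1p * Dh ^+ 2 / rho ^+ 2
                          + E * Num.sqrt m1p * DO / rho
                          + E `^ (2 / 3) * d0 `^ (2 / 3) * lambda `^ (- (1 / 3))
                            / rho `^ (2 / 3))) /\
        succeeds_within iter N (da_init y0)].
Proof.
(* The value 200 is that of [cubic_bound]. In (a) the number of iterations is [n + n] with
   [n <= 32 X + 1], and [64 X + 2] is below [200 (1 + X)]. *)
exists 200; split=> // Z ip f1 f2 h m1 M1 m2 M2 Omega rho y0 lambda theta.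
move=> fdip ch f1C1 f2C1 _ _ _ lip_f2 _ cl domO bO pO curv lip1 rho0 dy0 l0 th01.
move=> step_size input m1p Dh DO Dphi d0 E iter.
have ip_norm := fdip.1.
have ck : compact (dom h).
  apply: (closed_bounded_compact ip_norm fdip.2 cl); exact: dom_bounded domO bO.
have cf : continuous (fun u => f1 u + f2 u : R).
  by move=> u; apply: (@cvgD R R^o _ (nbhs u) _ f1);
    [exact: (C1_continuous f1C1)|exact: (C1_continuous f2C1)].
have [us usP] := argmin_add_exists ch ck cf.
have phi_us : phi_star f1 f2 h = phi f1 f2 h us.
  apply/le_anti/andP; split; first by apply: ereal_inf_lbound; exists us.
  by apply: le_ereal_inf_tmp => _ [u _ <-]; have [_] := usP; exact.
have [dus us_min] := (argmin_add_dom ch _ _).1 usP.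
have iter_ex s : da_inv h Omega s -> exists o, iter s o.
  move=> inv; exact: (da_iter_exists rho fdip ch cl domO bO pO l0 th01 input inv).
have iter_inv s s' : da_inv h Omega s -> iter s (Continue s') -> da_inv h Omega s'.
  exact: (da_inv_step fdip ch f2C1 lip_f2 domO bO pO curv lip1 l0 th01 step_size
    input rho0).
have inv0 := da_inv_init domO dy0.
have m1p0 : 0 <= m1p by rewrite /m1p le_max lexx orbT.
have E0 : 0 < E by exact: Econst_gt0.
have DO0 : 0 <= DO.
  by have := diam_le bO (domO _ dy0) (domO _ dy0); rewrite subrr normr0.
split.
- have DphiE : Dphi = rphi f1 f2 h y0 - rphi f1 f2 h us.
    by rewrite /Dphi phi_us !phiE.
  have Dphi0 : 0 <= Dphi by rewrite DphiE subr_ge0; exact: us_min.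
  set X := _ + _ / rho.
  have X0 : 0 <= X.
    apply: addr_ge0; apply: mulr_ge0; rewrite ?invr_ge0 ?sqr_ge0 ?(ltW rho0)//.
      by apply: mulr_ge0; rewrite ?sqr_ge0// addr_ge0// mulr_ge0// sqr_ge0.
    by apply: mulr_ge0 => //; apply: mulr_ge0; rewrite ?sqrtr_ge0// ltW.
  have [n [n0 nX nle]] := nat_gt (mulr_ge0 (ler0n R 32) X0).
  exists (n + n)%N; split; first by rewrite natrD; lra.
  apply: (stops_withinP iter_ex iter_inv inv0) => x xP.
  have := chain_length fdip ch f2C1 lip_f2 domO bO pO curv lip1 l0 th01 step_size
    input rho0 dy0 us_min n0 xP.
  by rewrite -DphiE -/X leNgt nX.
- move=> yh vh; rewrite /iter.
  move: (da_init y0) => s; move oE : (Some _) => o run.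
  elim: run oE => [//|{}s t it [tE]|s1 s2 o' _ _ IH /IH //].
  move: it; rewrite -tE; move sE : (Success _) => o'' it; case: it sE => //.
  move=> ya v eps yh' vh' _ _ srp small [-> ->].
  by split=> //; exact: (SRP_subdiff fdip ch f2C1 l0 input srp).
- move=> f2cvx.
  set X := _ + _ + _ / _.
  set T1 := E ^+ 2 * _ * _ / _ in X *; set T2 := E * _ * _ / _ in X *.
  set T3 := _ / _ in X *.
  have d0_ge0 : 0 <= d0.
    by apply: lb_le_inf => [|_ [u _ <-]//]; exists `|y0 - us|, us.
  have T1_ge0 : 0 <= T1.
    apply: mulr_ge0; rewrite ?invr_ge0 ?sqr_ge0//; apply: mulr_ge0; rewrite ?sqr_ge0//.
    by apply: mulr_ge0; rewrite ?sqr_ge0.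
  have T2_ge0 : 0 <= T2.
    by rewrite /T2 mulr_ge0 ?invr_ge0 ?(ltW rho0)// !mulr_ge0 ?sqrtr_ge0// ltW.
  have T3_ge0 : 0 <= T3 by rewrite /T3 !mulr_ge0 ?powR_ge0// invr_ge0 powR_ge0.
  have T3E : T3 ^+ 3 = (E / rho) ^+ 2 / lambda * d0 ^+ 2.
    rewrite /T3 !exprMn exprVn !powR_two_thirds_cube ?(ltW E0) ?(ltW rho0)//.
    by rewrite powR_minus_third_cube ?(ltW l0)//; field; rewrite !gt_eqF.
  have X0 : 0 <= X by rewrite /X !addr_ge0.
  have [n [n0 nX nle]] := nat_gt (mulr_ge0 (ler0n R 200) X0).
  exists n; split; first lra.
  have no_fail s : da_inv h Omega s ->
      ~ da_iter ip f1 f2 h lambda M2 Omega theta rho s Failure.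
    exact: (da_no_failure fdip ch f2C1 l0 input f2cvx).
  apply: (succeeds_withinP iter_ex iter_inv no_fail inv0) => x xP.
  have c0 : 0 < 96 * ((E / rho) ^+ 2 / lambda).
    by rewrite mulr_gt0// divr_gt0// exprn_gt0// divr_gt0.
  suff : n%:R ^+ 3 - 192 * (n%:R * T2 ^+ 2 + n%:R ^+ 2 * T1 / 2) <= 96 * T3 ^+ 3.
    move=> H; have : n%:R <= 200 * (T1 + T2 + T3) by apply: cubic_bound => //; lra.
    by rewrite leNgt nX.
  have -> : 96 * T3 ^+ 3 = d0 ^+ 2 * (96 * ((E / rho) ^+ 2 / lambda)).
    by rewrite T3E; ring.
  rewrite -ler_pdivrMr//.
  rewrite /d0 /dist_argmin; apply: le_sqr_inf; first by exists `|y0 - us|, us.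
  move=> _ [u uP <-]; split=> //.
  have du : dom h u.
    move: uP; rewrite phi_us phiE// /dom /phi /=.
    by case: (h u) => [r _||]; rewrite ?ltry ?ltNyr//= addey.
  have u_min w : dom h w -> rphi f1 f2 h u <= rphi f1 f2 h w.
    move=> dw; have /= := uP; rewrite phi_us !phiE// => -[->]; exact: us_min.
  rewrite ler_pdivrMr// [X in _ <= X]mulrC.
  exact: (convex_chain_length fdip ch f2C1 lip_f2 domO bO pO curv lip1 l0 th01 step_size
    input rho0 dy0 du u_min f2cvx xP).
Qed.
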